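(* Let $\tilde{\mathcal V}$ be a pseudoconvex formal-analytic arithmetic surface over $\mathrm{Spec}(\mathbb Z)$, with underlying bordered Riemann surface $(V^+,V)$, distinguished point $O\in V^\circ$, antiholomorphic involution $\sigma$ and gluing map $\psi$, and let $\varphi$ be the compositional inverse of $\psi$. Suppose there is a nonconstant power series $f\in\mathbb Z[[T]]$ with $f(0)=0$ which is monic, i.e. $f=T^e+\sum_{n>e}a_nT^n$ with $e\ge 1$, such that $\phi=f\circ\varphi$ is holomorphic on some neighborhood of $V$. Suppose moreover that the following implication (the conjecture for $\phi$) holds: if $\log\|\phi^{[e]}(O)\|^{\mathrm{cap},\otimes e}_{V,O}<0$ and $\phi\circ\sigma=\overline{\phi}$, then there exists a monic polynomial $p(X)\in\mathbb R[X]$ such that $\inf_{x\in V}\left|p\left(\frac{1}{\phi(x)}\right)\right|>1$. Then the set of power series $g\in\mathbb Z[[T]]$ such that $g\circ\varphi$ is holomorphic on some neighborhood of $V$ has the cardinality of the continuum.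
   Context: Bordered Riemann surfaces. A Riemann surface with boundary is a pair $(V^+,V)$, where $V^+$ is a connected Riemann surface without boundary and $V\subset V^+$ is a compact connected $\mathcal C^\infty$ submanifold with boundary of codimension $0$, with interior $V^\circ$ and nonempty boundary $\partial V=V\setminus V^\circ$. $V^+$ is regarded as a germ of Riemann surface along $V$ (it may be replaced by a smaller open neighborhood of $V$, stable under $\sigma$ when $\sigma$ is given). Green's function and capacitary norm. For $O\in V^\circ$, the equilibrium Green's function $g_{V,O}:V^+\setminus\{O\}\to\mathbb R$ is the unique function that is continuous, vanishes on $V^+\setminus V^\circ$, is harmonic on $V^\circ\setminus\{O\}$, and is such that $g_{V,O}-\log(|z|^{-1})$ is bounded near $O$ for a local coordinate $z$ at $O$ with $z(O)=0$. Put $c=\lim_{w\to O}\big(g_{V,O}(w)-\log(|z(w)|^{-1})\big)$. The capacitary norm on $T_OV$ is defined by $\|\partial/\partial z\|^{\mathrm{cap}}_{V,O}=e^{-c}$ (independent of $z$). By duality and tensor powers it induces a norm $\|\cdot\|^{\mathrm{cap},\otimes e}_{V,O}$ on $(T_OV^\vee)^{\otimes e}$, with $\|(dz)^{\otimes e}\|^{\mathrm{cap},\otimes e}_{V,O}=e^{ec}$. If a function $\phi$ has vanishing order $e$ at $O$, $\phi=b_ez^e+O(z^{e+1})$ with $b_e\neq0$, then $\phi^{[e]}(O)=b_e(dz)^{\otimes e}$ is its $e$-th jet, so $\|\phi^{[e]}(O)\|^{\mathrm{cap},\otimes e}_{V,O}=|b_e|e^{ec}$. Formal-analytic arithmetic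 surfaces over $\mathbb Z$. Such a surface $\tilde{\mathcal V}$ consists of: a Noetherian affine formal scheme $\widehat{\mathcal V}=\mathrm{Spf}(B)$ over $\mathbb Z$, formally smooth with one-dimensional fibers and with reduced scheme of definition mapping isomorphically to $\mathrm{Spec}(\mathbb Z)$, so that $\widehat{\mathcal V}\cong\mathrm{Spf}(\mathbb Z[[T]])$ (such a $T$ is fixed); a Riemann surface with boundary $(V^+,V)$ with a point $O\in V^\circ$; an isomorphism (gluing map) $\psi$ from $\mathrm{Spf}(\mathbb C[[T]])$ to the formal completion $\widehat V_O$ of $V$ at $O$; and an antiholomorphic involution $\sigma$ of $V^+$ preserving $V$ and fixing $O$, compatible with $\psi$ and complex conjugation on $\mathbb C[[T]]$. The compositional inverse $\varphi$ of $\psi$ is, in a local coordinate $z$ at $O$ with $z(O)=0$, a formal power series $\varphi=\sum_{i\ge1}c_iz^i$ with $c_1\ne0$; compatibility with $\sigma$ means that all $c_i$ are real when $z$ is chosen with $z\circ\sigma=\overline z$. For $g\in\mathbb Z[[T]]$, ''$g\circ\varphi$ is holomorphic on some neighborhood of $V$'' means that the formal germ $g\circ\varphi\in\mathbb C[[z]]$ is the Taylor expansion at $O$ of a holomorphic function on a connected open neighborhood of $V$ in $V^+$; that function is also denoted $g\circ\varphi$. Pseudoconvexity. Let $P:\mathrm{Spec}(\mathbb Z)\to\widehat{\mathcal V}$ be the canonical section ($T=0$). Its normal bundle is the free $\mathbb Z$-module generated by $\partial/\partial T$; transporting to $T_OV$ through $\psi$ and using the capacitary norm gives the Hermitian line bundle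 $\overline N_P(\tilde{\mathcal V})$ over $\mathrm{Spec}(\mathbb Z)$, of Arakelov degree $\widehat{\deg}\,\overline N_P(\tilde{\mathcal V})=-\log\|D\psi(\partial/\partial T)\|^{\mathrm{cap}}_{V,O}$. $\tilde{\mathcal V}$ is pseudoconvex if $\widehat{\deg}\,\overline N_P(\tilde{\mathcal V})<0$. Convention: for nonconstant $p$, $|p(1/\phi(x))|=+\infty$ when $\phi(x)=0$. *)

(* Defs.v *)
From mathcomp Require Import all_boot all_order all_algebra.
From mathcomp Require Import complex.
From mathcomp Require Import all_classical all_reals all_analysis.

Set Implicit Arguments.
Unset Strict Implicit.
Unset Printing Implicit Defensive.

Import Order.TTheory GRing.Theory Num.Theory.
Import numFieldNormedType.Exports.

Local Open Scope classical_set_scope.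
Local Open Scope ring_scope.

(* Complex numbers with their usual topology. [derivable f w 1], for
   [f : CC R -> CC R], is complex differentiability of [f] at [w]. *)
Notation CC R := ((complex R)^o).

Section Plane.
Context {R : realType}.

Definition dir_x : R * R := (1, 0).
Definition dir_y : R * R := (0, 1).

(* [f] is of class C^n on [D]. This has its usual meaning for open [D], the
   only case used below. *)
Fixpoint class_C (n : nat) (D : set (R * R)) (f : R * R -> R) : Prop :=
  (forall p, D p -> {for p, continuous f}) /\
  if n is m.+1 then
    [/\ forall p, D p -> derivable f p dir_x /\ derivable f p dir_y,
        class_C m D ('D_dir_x f) & class_C m D ('D_dir_y f)]
  else True.

Definition laplacian (f : R * R -> R) : R * R -> R :=
  fun p => 'D_dir_x ('D_dir_x f) p + 'D_dir_y ('D_dir_y f) p.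

Definition plane_to_CC (p : R * R) : CC R := Complex p.1 p.2.

End Plane.

(* [cinv] is meaningful on the image of [cdom] only. *)
Record chart (R : realType) (M : topologicalType) := Chart {
  cdom : set M;
  cmap : M -> CC R;
  cinv : CC R -> M;
  cdom_open : open cdom;
  cimg_open : open (cmap @` cdom);
  cmapK : forall x, cdom x -> cinv (cmap x) = x;
  cmap_cont : forall x, cdom x -> {for x, continuous cmap};
  cinv_cont : forall w, (cmap @` cdom) w -> {for w, continuous cinv} }.

(* The transition map from [k] to [l] is holomorphic. *)
Definition holo_transition (R : realType) (M : topologicalType)
    (k l : chart R M) : Prop :=
  forall x, cdom k x -> cdom l x ->
    derivable (cmap l \o cinv k : CC R -> CC R) (cmap k x) 1.

(* Second countability is automatic for connected Riemann surfaces (Rado). *)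
Record riemann_surface (R : realType) := RiemannSurface {
  rs_space :> topologicalType;
  rs_hausdorff : hausdorff_space rs_space;
  rs_connected : connected [set: rs_space];
  rs_atlas : set (chart R rs_space);
  rs_cover : forall x, exists2 k, rs_atlas k & cdom k x;
  rs_compat : forall k l, rs_atlas k -> rs_atlas l -> holo_transition k l }.

Section RiemannSurfaces.
Context {R : realType} (S : riemann_surface R).
Implicit Types (U V : set S) (k l : chart R S).

(* [k] belongs to the maximal atlas. *)
Definition holo_coordinate k : Prop :=
  forall l, rs_atlas l -> holo_transition k l /\ holo_transition l k.

(* In the next definitions [U] is meant to be open. *)
Definition holomorphic_on U (F : S -> CC R) : Prop :=
  forall x k, U x -> rs_atlas k -> cdom k x ->
    derivable (F \o cinv k : CC R -> CC R) (cmap k x) 1.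

Definition antiholomorphic (s : S -> S) : Prop :=
  continuous s /\
  forall x k l, rs_atlas k -> rs_atlas l -> cdom k x -> cdom l (s x) ->
    derivable (fun w : CC R => (cmap l (s (cinv k w)))^*%C : CC R)
      (cmap k x) 1.

Definition chart_plane_dom k U : set (R * R) :=
  [set p | (cmap k @` (U `&` cdom k)) (plane_to_CC p)].

Definition in_chart k (u : S -> R) : R * R -> R :=
  fun p => u (cinv k (plane_to_CC p)).

Definition smooth_on U (u : S -> R) : Prop :=
  forall k n, rs_atlas k -> class_C n (chart_plane_dom k U) (in_chart k u).

Definition harmonic_on U (u : S -> R) : Prop :=
  forall k, rs_atlas k ->
    class_C 2 (chart_plane_dom k U) (in_chart k u) /\
    (forall p, chart_plane_dom k U p -> laplacian (in_chart k u) p = 0).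

(* [h] is a C^oo diffeomorphism from the open set [U] onto an open set of the
   plane, with inverse [h'], under which [V] corresponds to the closed upper
   half-plane. *)
Definition half_plane_chart V U (h : S -> R * R) (h' : R * R -> S) : Prop :=
  [/\ open U /\ open (h @` U),
      forall y, U y -> h' (h y) = y,
      smooth_on U (fst \o h) /\ smooth_on U (snd \o h),
      (forall p, (h @` U) p -> {for p, continuous h'}) /\
      (forall k n, rs_atlas k ->
         class_C n (h @` (U `&` cdom k)) (fun p => complex.Re (cmap k (h' p))) /\
         class_C n (h @` (U `&` cdom k)) (fun p => complex.Im (cmap k (h' p)))) &
      forall y, U y -> (V y <-> 0 <= (h y).2)].

(* Interior points of [V] are covered by charts on which [(h y).2 > 0]; so the
   interior of the manifold [V] is its topological interior in [S]. *)
Definition smooth_domain V : Prop :=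
  forall x, V x -> exists U h h', U x /\ half_plane_chart V U h h'.

End RiemannSurfaces.

Record bordered_surface (R : realType) := BorderedSurface {
  bs_plus :> riemann_surface R;
  bs_V : set bs_plus;
  bs_compact : compact bs_V;
  bs_connected : connected bs_V;
  bs_smooth : smooth_domain bs_V;
  bs_boundary : bs_V `\` interior bs_V !=set0 }.

(* A formal power series is its sequence of coefficients. [fps_comp g h] is the
   series [g o h], for [h] without constant term: the terms [g k * h ^ k] with
   [k > n] and the coefficients [h i] with [i > n] do not contribute to the
   coefficient of degree [n]. *)
Definition fps_comp (A : comNzRingType) (g h : nat -> A) : nat -> A :=
  fun n => (\sum_(k < n.+1) g k *: (\poly_(i < n.+1) h i) ^+ k)`_n.

Definition fps_X (A : comNzRingType) : nat -> A := fun n => (n == 1%N)%:R.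

(* The formal scheme is Spf Z[[T]], for the fixed [T]. The formal completion at
   O is Spf C[[z]], where [fa_z] is a local coordinate satisfying
   [z o sigma = conj z]; the gluing map is [z = psi(T)], its compositional
   inverse is [T = phi(z)]. *)
Record formal_analytic_surface (R : realType) := FormalAnalyticSurface {
  fa_bordered :> bordered_surface R;
  fa_O : fa_bordered;
  fa_O_interior : interior (bs_V (b := fa_bordered)) fa_O;
  fa_sigma : fa_bordered -> fa_bordered;
  fa_sigma_anti : antiholomorphic fa_sigma;
  fa_sigma_invol : involutive fa_sigma;
  fa_sigma_V : fa_sigma @` bs_V (b := fa_bordered) = bs_V (b := fa_bordered);
  fa_sigma_O : fa_sigma fa_O = fa_O;
  fa_z : chart R fa_bordered;
  fa_z_coord : holo_coordinate fa_z;
  fa_z_dom : cdom fa_z fa_O;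
  fa_z_O : cmap fa_z fa_O = 0;
  fa_z_sigma : \forall x \near fa_O,
    cmap fa_z (fa_sigma x) = (cmap fa_z x)^*%C;
  fa_psi : nat -> R[i];
  fa_phi : nat -> R[i];
  fa_psi0 : fa_psi 0 = 0;
  fa_phi0 : fa_phi 0 = 0;
  fa_psiK : fps_comp fa_phi fa_psi = fps_X R[i];
  fa_phiK : fps_comp fa_psi fa_phi = fps_X R[i];
  fa_phi_real : forall i, (fa_phi i)^*%C = fa_phi i }.

Section FormalAnalytic.
Context {R : realType} (D : formal_analytic_surface R).

Notation V := (bs_V (b := D)).
Notation O := (fa_O D).
Notation z := (cmap (fa_z D)).

Definition log_abs_inv_z (x : D) : R := ln (Normc.normc (z x))^-1.

(* The value of [g] at [O] is irrelevant. *)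
Definition is_green (g : D -> R) : Prop :=
  [/\ forall x, x <> O -> {for x, continuous g},
      forall x, ~ interior V x -> g x = 0,
      harmonic_on (interior V `\ O) g &
      exists B : R, \forall x \near O^', `|g x - log_abs_inv_z x| <= B].

(* Existence, and uniqueness away from [O], are classical. *)
Definition green : D -> R := xget (fun=> 0) is_green.

Definition green_const : R :=
  lim ((fun x => green x - log_abs_inv_z x) @ O^').

(* The norm of [a d/dz]. *)
Definition cap_norm (a : R[i]) : R := Normc.normc a * expR (- green_const).

(* The induced norm of [b (dz)^e]. *)
Definition cap_norm_dual_pow (e : nat) (b : R[i]) : R :=
  Normc.normc b * (cap_norm 1)^-1 ^+ e.

(* D psi (d/dT) = psi'(0) d/dz. *)
Definition deg_normal_bundle : R := - ln (cap_norm (fa_psi D 1)).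

Definition pseudoconvex : Prop := deg_normal_bundle < 0.

(* The expansion of [g o phi] in powers of [z]. *)
Definition formal_germ (g : nat -> int) : nat -> R[i] :=
  fps_comp (fun n => (g n)%:~R) (fa_phi D).

Definition taylor_at_O (F : D -> CC R) (a : nat -> R[i]) : Prop :=
  \forall x \near O, series (fun n => a n * z x ^+ n : CC R) @ \oo --> F x.

(* [F] is holomorphic on a connected open neighborhood of [V] and is
   represented at [O] by the formal germ [a]; its values away from that
   neighborhood are irrelevant. *)
Definition holomorphic_near_V (a : nat -> R[i]) (F : D -> CC R) : Prop :=
  exists W : set D,
    [/\ open W, connected W, V `<=` W, holomorphic_on W F & taylor_at_O F a].

(* [F o sigma = conj F] as germs along [V]. *)
Definition sigma_real (F : D -> CC R) : Prop :=
  exists U : set D, [/\ open U, V `<=` U &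
    forall x, U x -> F (fa_sigma x) = (F x)^*%C].

(* [|p(1/y)|], equal to +oo when [y = 0] and [p] is nonconstant. *)
Definition abs_eval_inv (p : {poly R}) (y : R[i]) : \bar R :=
  if (y == 0) && (1 < size p)%N then +oo%E
  else (Normc.normc (map_poly (real_complex R) p).[y^-1])%:E.

Definition inf_abs_eval_inv (p : {poly R}) (F : D -> CC R) : \bar R :=
  ereal_inf [set abs_eval_inv p (F x) | x in V].

Definition integral_holomorphic_series : set (nat -> int) :=
  [set g | exists F, holomorphic_near_V (formal_germ g) F].

End FormalAnalytic.

(* Main.v *)
(** If the degree of the normal bundle is negative, the capacitary norm of the
    leading jet of phi = f o varphi is < 1, and phi commutes with the real
    structures near O, hence near V by the identity theorem; so the conjecture
    provides a monic real p of degree d with |p(1/phi)| > 1 on V.  Let p^* be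
    the reversed polynomial and h(X) = X^d / p^*(X), so that |h(phi)| < 1 near
    V.  The real series X^(m mod d) h^(m div d) are X^m + higher order terms;
    hence for each 0-1 sequence one can choose greedily coefficients b_m, each
    in one of the two half-open intervals [0, 1), [1, 2) prescribed by the
    sequence, such that sum_m b_m X^(m mod d) h^(m div d) has integer
    coefficients.  The series in f so obtained are pairwise distinct, and they
    converge near V since the b_m are bounded.

    The identity theorem for functions that are only assumed to be complex
    differentiable at each point is proved by Goursat's bisection, which yields
    a primitive P; being twice differentiable, P (w) / w ^ n satisfies a
    four-point mean value estimate, hence a maximum principle, and letting n
    grow shows that P vanishes as soon as it vanishes near 0. *)
Require Import Defs.
From mathcomp Require Import all_boot all_order all_algebra.
From mathcomp Require Import complex.
From mathcomp Require Import all_classical all_reals all_analysis.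
From mathcomp Require Import ring lra.
Import Order.TTheory GRing.Theory Num.Theory.
Import numFieldNormedType.Exports.
Local Open Scope classical_set_scope.
Local Open Scope card_scope.
Local Open Scope ring_scope.

Set Implicit Arguments.
Unset Strict Implicit.
Unset Printing Implicit Defensive.

(** Replacing [X^m] by [X^(m mod d) h^(m div d)] keeps the leading term [X^m], so the integrality
    conditions remain a unitriangular system, while the sum splits into [d] power series in [h], for
    which [|h(phi)| < 1] suffices. Both intervals for [b_m] have length one, so each contains
    exactly one admissible real, and the choice can be read back from the integer coefficient.

    The delicate point is the comparison of the function so defined with the formal germ: its Taylor
    series at O must be the formal composite with [f] and [phi]. Instead of rearranging multiple
    series, polynomials are used that agree with the composite below degree [N], have
    coefficientwise majorants at twice the radius bounded independently of [N], and converge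
    pointwise to the function. The doubled radius makes the remainder of order [2^-N], so the
    partial sums of the formal series have the same limit. *)

Local Notation normc := Normc.normc.
Local Notation Re := complex.Re.
Local Notation Im := complex.Im.

(** * Complex differentiability *)

Section ComplexBasics.
Context {R : realType}.
Implicit Types (a w z l k : CC R) (f g : CC R -> CC R).

Lemma normcE w : `|w| = (normc w)%:C%C.
Proof. by case: w. Qed.

Lemma normc_ge0 w : 0 <= normc w.
Proof. by case: w => x y /=; rewrite sqrtr_ge0. Qed.

Lemma normcD w z : normc (w + z) <= normc w + normc z.
Proof. exact: le_normcD. Qed.

Lemma normcN w : normc (- w) = normc w.
Proof. exact: complex.normcN. Qed.

Lemma normcB w z : normc (w - z) = normc (z - w).
Proof. by rewrite -normcN opprB. Qed.

Lemma normc_dist w z : `|normc w - normc z| <= normc (w - z).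
Proof.
rewrite ler_norml; apply/andP; split.
  have := normcD (z - w) w; rewrite subrK normcB; lra.
by have := normcD (w - z) z; rewrite subrK; lra.
Qed.

Lemma normcX w n : normc (w ^+ n) = normc w ^+ n.
Proof.
elim: n => [|n IH]; first by rewrite !expr0 Normc.normc1.
by rewrite !exprS Normc.normcM IH.
Qed.

Lemma normc_eq0 w : (normc w == 0) = (w == 0).
Proof.
apply/eqP/eqP => [/Normc.eq0_normc//|->]; exact: Normc.normc0.
Qed.

Lemma normc_gt0 w : (0 < normc w) = (w != 0).
Proof. by rewrite lt_def normc_ge0 normc_eq0 andbT. Qed.

Lemma normc_real (x : R) : normc x%:C%C = `|x|.
Proof. by rewrite /= expr0n addr0 sqrtr_sqr. Qed.

Lemma normc_conj w : normc w^*%C = normc w.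
Proof. by case: w => x y /=; rewrite sqrrN. Qed.

Lemma Re_le_normc w : `|Re w| <= normc w.
Proof.
by case: w => x y /=; rewrite -sqrtr_sqr ler_sqrt ?addr_ge0 ?sqr_ge0// lerDl sqr_ge0.
Qed.

Lemma Im_le_normc w : `|Im w| <= normc w.
Proof.
by case: w => x y /=; rewrite -sqrtr_sqr ler_sqrt ?addr_ge0 ?sqr_ge0// lerDr sqr_ge0.
Qed.

Lemma normc_le_ReIm w : normc w <= `|Re w| + `|Im w|.
Proof.
case: w => x y; have -> : Complex x y = x%:C%C + Complex 0 y :> CC R.
  by rewrite /real_complex_def; congr Complex; rewrite ?addr0 ?add0r.
apply: le_trans (normcD _ _) _.
by rewrite normc_real /= expr0n add0r sqrtr_sqr addr0 add0r.
Qed.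

Lemma nbhs_normcP a (P : set (CC R)) :
  nbhs a P <-> exists2 e : R, 0 < e & forall w, normc (w - a) < e -> P w.
Proof.
split=> [/nbhs_ballP[e /= e0 eP]|[e e0 eP]].
  have /= := e0; rewrite ltcE => /andP[/eqP /= ie re].
  exists (Re e) => // w we; apply: eP => /=.
  have -> : e = (Re e)%:C%C by move: ie; case: (e) => x y /= ->.
  by rewrite /ball /= normcE ltcR normcB.
apply/nbhs_ballP; exists (e%:C%C) => /=; first by rewrite ltcR.
by move=> w; rewrite /ball /= normcE ltcR normcB => /eP.
Qed.

Lemma cvg_normcP (T : Type) (F : set_system T) {FF : Filter F} (f : T -> CC R) l :
  f @ F --> l <-> forall e : R, 0 < e -> \forall x \near F, normc (f x - l) < e.
Proof.
split=> [fl e e0|fl].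
  apply: (fl (fun w => normc (w - l) < e)).
  by apply/nbhs_normcP; exists e.
move=> P /nbhs_normcP[e e0 eP]; have := fl e e0.
by apply: filterS => x; exact: eP.
Qed.

Lemma cts_normcP f a :
  {for a, continuous f} <-> forall e : R, 0 < e -> exists2 d : R, 0 < d &
    forall w, normc (w - a) < d -> normc (f w - f a) < e.
Proof.
split=> [fa e e0|fa P /nbhs_normcP[e e0 eP]].
  have /nbhs_normcP[//] : nbhs a (f @^-1` [set w | normc (w - f a) < e]).
    by apply: fa; apply/nbhs_normcP; exists e.
  by move=> d d0 dP; exists d.
by have [d d0 dP] := fa _ e0; apply/nbhs_normcP; exists d => // w /dP /eP.
Qed.

(** Clearing the denominator of the difference quotient admits [h = 0] and turns later proofs of
    differentiability into inequalities between real norms. *)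
Lemma is_deriveCP f a l :
  is_derive (a : CC R) (1 : CC R) f l <->
  forall e : R, 0 < e -> exists2 d : R, 0 < d & forall h,
    normc h < d -> normc (f (a + h) - f a - l * h) <= e * normc h.
Proof.
have E (l' h : CC R) : h != 0 -> normc (h^-1 *: (f (h *: (1 : CC R) + a) - f a) - l') =
    (normc h)^-1 * normc (f (a + h) - f a - l' * h).
  move=> h0; rewrite -Normc.normcV -Normc.normcM mulrBr [l' * h]mulrC mulKf //.
  by rewrite /GRing.scale /= mulr1 [h + a]addrC.
split=> [[dfa <-] e e0|fl].
  have /cvg_normcP /(_ _ e0) : (fun h : CC R => h^-1 *: (f (h *: (1 : CC R) + a) - f a)) @
      0^' --> 'D_1 f a by [].
  rewrite /dnbhs near_withinE => /nbhs_normcP[d d0 dP]; exists d => // h hd.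
  have [->|h0] := eqVneq h 0.
    by rewrite addr0 subrr mulr0 subr0 Normc.normc0 mulr0.
  have H := dP h; rewrite subr0 in H.
  have H2 : (normc h)^-1 * normc (f (a + h) - f a - 'D_1 f a * h) < e.
    rewrite -(E _ h h0); exact: H hd h0.
  rewrite -ler_pdivrMr ?normc_gt0 // mulrC; exact: ltW.
have H : (fun h : CC R => h^-1 *: (f (h *: (1 : CC R) + a) - f a)) @ 0^' --> l.
  apply/cvg_normcP => e e0; have e20 : 0 < e / 2 by rewrite divr_gt0.
  have [d d0 dP] := fl _ e20; rewrite /dnbhs near_withinE.
  apply/nbhs_normcP; exists d => // h; rewrite subr0 => hd h0.
  rewrite (E l h h0); apply: (@le_lt_trans _ _ (e / 2)); last by lra.
  by rewrite mulrC ler_pdivrMr ?normc_gt0 // dP.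
split; first by apply/cvg_ex; exists l.
exact/cvg_lim.
Qed.

Lemma is_derive_cts f a l : is_derive (a : CC R) (1 : CC R) f l -> {for a, continuous f}.
Proof. by move=> [/derivable1_diffP/differentiable_continuous]. Qed.

Lemma derivable_ext f g a : (\forall w \near a, f w = g w) ->
  derivable f a 1 -> derivable g a 1.
Proof.
move=> /nbhs_normcP[r r0 rP] /derivableP /is_deriveCP fa.
suff : is_derive (a : CC R) (1 : CC R) g ('D_1 f a) by case.
apply/is_deriveCP => e /fa[d d0 dP]; exists (Num.min d r); first by rewrite lt_min d0.
move=> h; rewrite lt_min => /andP[hd hr].
rewrite -!rP ?dP // ?subrr ?Normc.normc0 //.
by rewrite addrAC subrr add0r.
Qed.

Lemma is_derive_comp f g a l k :
  is_derive (a : CC R) (1 : CC R) f l -> is_derive (f a : CC R) (1 : CC R) g k ->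
  is_derive (a : CC R) (1 : CC R) (g \o f) (k * l).
Proof.
move=> /is_deriveCP fa /is_deriveCP ga; apply/is_deriveCP => e e0.
(* The error of [g] at the increment [k1] is at most [e1 * (|l| + 1) * |h|], and that of [f],
   multiplied by [k], at most [|k| * e1 * |h|]; together [e1 * M * |h|]. *)
pose M := normc l + 1 + normc k; have M0 : 0 < M.
  by rewrite /M; have := normc_ge0 l; have := normc_ge0 k; lra.
pose e1 := Num.min 1 (e / (2 * M)).
have e10 : 0 < e1 by rewrite lt_min ltr01 divr_gt0 ?mulr_gt0.
have e11 : e1 <= 1 by rewrite ge_min lexx.
have e1e : e1 * M <= e / 2.
  rewrite -ler_pdivlMr // ge_min; apply/orP; right.
  by rewrite invfM mulrA.
have [d1 d10 d1P] := fa _ e10; have [d2 d20 d2P] := ga _ e10.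
exists (Num.min d1 (d2 / (normc l + 1))).
  rewrite lt_min d10 divr_gt0 //; have := normc_ge0 l; lra.
move=> h; rewrite lt_min => /andP[hd1 hd2]; pose k1 := f (a + h) - f a.
have k1P : normc (k1 - l * h) <= e1 * normc h by exact: d1P.
have k1l : normc k1 <= (normc l + 1) * normc h.
  have := normcD (k1 - l * h) (l * h); rewrite subrK Normc.normcM.
  have := normc_ge0 h; nra.
have /d2P : normc k1 < d2.
  apply: le_lt_trans k1l _; rewrite mulrC -ltr_pdivlMr //.
  by have := normc_ge0 l; lra.
have -> : f a + k1 = f (a + h) by rewrite /k1 addrCA subrr addr0.
rewrite /= => k1g.
have -> : g (f (a + h)) - g (f a) - k * l * h =
  (g (f (a + h)) - g (f a) - k * k1) + k * (k1 - l * h) by ring.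
apply: le_trans (normcD _ _) _; rewrite Normc.normcM.
have h0 := normc_ge0 h; have kk0 := normc_ge0 k; have l0 := normc_ge0 l.
have A1 : e1 * normc k1 <= e1 * ((normc l + 1) * normc h) by rewrite ler_pM2l.
have A2 : normc k * normc (k1 - l * h) <= normc k * (e1 * normc h) by rewrite ler_wpM2l.
have A3 : e1 * M * normc h <= e / 2 * normc h by rewrite ler_wpM2r.
rewrite /M in A3; nra.
Qed.

Lemma derivable_comp f g a : derivable f (a : CC R) 1 -> derivable g (f a : CC R) 1 ->
  derivable (g \o f) a 1.
Proof.
by move=> /derivableP fa /derivableP ga; have [] := is_derive_comp fa ga.
Qed.

(** Schwarz reflection: conjugation is an isometric ring morphism, so it carries one first-order
    expansion to the other. *)
Lemma derivable_conj f a : derivable f (a : CC R) 1 ->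
  derivable (fun w : CC R => (f w^*%C)^*%C : CC R) (a^*%C : CC R) 1.
Proof.
move=> /derivableP/is_deriveCP fa.
suff : is_derive (a^*%C : CC R) 1 (fun w : CC R => (f w^*%C)^*%C : CC R) (('D_1 f a)^*)%C by
    case.
apply/is_deriveCP => e /fa[d d0 dP]; exists d => // h hd.
have := dP (h^*%C : CC R); rewrite normc_conj => /(_ hd).
rewrite -[normc (_ - _ - _)]normc_conj !rmorphB rmorphM /= rmorphD /= !conjcK.
by [].
Qed.

Lemma ReD w z : Re (w + z) = Re w + Re z. Proof. by case: w; case: z. Qed.
Lemma ImD w z : Im (w + z) = Im w + Im z. Proof. by case: w; case: z. Qed.
Lemma ReN w : Re (- w) = - Re w. Proof. by case: w. Qed.
Lemma ImN w : Im (- w) = - Im w. Proof. by case: w. Qed.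
Lemma ReM w z : Re (w * z) = Re w * Re z - Im w * Im z.
Proof. by case: w; case: z. Qed.
Lemma ImM w z : Im (w * z) = Re w * Im z + Im w * Re z.
Proof. by case: w; case: z. Qed.

End ComplexBasics.

(** * Goursat's theorem and primitives *)

Section RealLine.
Context {R : realType}.
Implicit Types (a b t r : R).

(** The room between [r] and [s] gives continuity, hence integrability, on the closed interval
    [[- r, r]]. *)
Lemma real_primitive (g : R -> R) r s : r < s ->
  (forall t, `|t| < s -> {for t, continuous g}) ->
  exists G : R -> R, forall t, `|t| < r -> is_derive t 1 G (g t).
Proof.
move=> rs gc; pose m : R := r.
exists (fun x => (\int[lebesgue_measure]_(t in `[- r, x]) g t)%R) => t tr.
have r0 : 0 < r by apply: le_lt_trans tr.
have tr1 : t < r by apply: le_lt_trans tr; apply: ler_norm.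
have tr2 : - r < t by move: tr; rewrite ltr_norml => /andP[].
have gi : lebesgue_measure.-integrable `[- r, r] (EFin \o g).
  apply: continuous_compact_integrable; first exact: segment_compact.
  apply: continuous_in_subspaceT => x; rewrite inE /= in_itv /= => xr.
  by apply: gc; apply: le_lt_trans rs; rewrite ler_norml.
have ts : `|t| < s by apply: lt_trans rs.
have [dG G'] := continuous_FTC1_closed tr1 gi tr2 (gc _ ts).
by apply: DeriveDef; [exact: dG|rewrite -derive1E; exact: G'].
Qed.

(** Mean value theorem for [G] minus the quadratic primitive of the affine function. *)
Lemma primitive_affine_bound (g G : R -> R) (a b p q e : R) : a <= b ->
  (forall t, a <= t <= b -> is_derive t 1 G (g t)) ->
  (forall t, a <= t <= b -> `|g t - p - q * t| <= e) ->
  `|G b - G a - p * (b - a) - q * ((b ^+ 2 - a ^+ 2) / 2)| <= e * (b - a).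
Proof.
move=> ab dG ge.
pose H t := G t - (p * t + q / 2 * t ^+ 2).
have dH t : a <= t <= b -> is_derive t 1 H (g t - (p + q * t)).
  move=> tab; have := dG t tab => ?.
  apply: is_derive_eq; rewrite /GRing.scale /= !mulr1; congr (_ - (_ + _)); by field.
have dH' x : x \in `]a, b[ -> is_derive x 1 H (g x - (p + q * x)).
  by rewrite in_itv /= => /andP[ax xb]; apply: dH; rewrite !ltW.
have cH : {within `[a, b], continuous H}.
  apply: continuous_in_subspaceT => x; rewrite inE /= in_itv /= => xab.
  by apply/differentiable_continuous/derivable1_diffP; have [] := dH x xab.
have [c cab E] := MVT_segment ab dH' cH.
have -> : G b - G a - p * (b - a) - q * ((b ^+ 2 - a ^+ 2) / 2) = H b - H a.
  by rewrite /H; field.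
rewrite E normrM [`|b - a|]ger0_norm ?subr_ge0 // ler_wpM2r ?subr_ge0 //.
by rewrite opprD addrA; apply: ge; move: cab; rewrite in_itv.
Qed.

End RealLine.

Section Goursat.
Context {R : realType}.
Implicit Types (g : R -> CC R) (f : CC R -> CC R) (w : CC R).

(* Comparison with affine functions is all that is used of the integral. *)
Definition line_integral (r : R) g (G : R -> CC R) : Prop :=
  forall a b (p q : CC R) (e : R), `|a| < r -> `|b| < r ->
  (forall t, `|t| < r -> Num.min a b <= t <= Num.max a b ->
     normc (g t - p - q * t%:C%C) <= e) ->
  normc (G b - G a - p * (b - a)%:C%C - q * ((b ^+ 2 - a ^+ 2) / 2)%:C%C)
   <= 2 * e * `|b - a|.

(** Real and imaginary parts are integrated separately, each with error [e * |b - a|]; this is the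
    factor 2 in [line_integral]. *)
Lemma line_primitive g r s : r < s ->
  (forall t, `|t| < s -> {for t, continuous (fun t => Re (g t))}) ->
  (forall t, `|t| < s -> {for t, continuous (fun t => Im (g t))}) ->
  exists G, line_integral r g G.
Proof.
move=> rs cRe cIm.
have [G1 dG1] := real_primitive rs cRe; have [G2 dG2] := real_primitive rs cIm.
exists (fun t => Complex (G1 t) (G2 t)) => a b p q e.
wlog ab : a b / a <= b => [H ar br|ar br].
  case/orP: (le_total a b) => [ab|ba]; first exact: (H a b ab ar br).
  rewrite minC maxC => Hg; have := H b a ba br ar Hg.
  rewrite -normcN [`|a - b|]distrC.
  suff -> : - (Complex (G1 a) (G2 a) - Complex (G1 b) (G2 b) - p * (a - b)%:C%C - q * ((a ^+
      2 - b ^+ 2) / 2)%:C%C) = (Complex (G1 b) (G2 b) - Complex (G1 a) (G2 a) - p * (b -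
          a)%:C%C - q * ((b ^+ 2 - a ^+ 2) / 2)%:C%C) by [].
  by case: (p) => p1 p2; case: (q) => q1 q2; congr Complex => /=; field.
rewrite (min_idPl ab) (max_idPr ab) => Hg.
have Hr t : a <= t <= b -> `|t| < r.
  move=> /andP[at_ tb]; rewrite ltr_norml; move: ar br; rewrite !ltr_norml; lra.
have E1 t : a <= t <= b -> `|Re (g t) - Re p - Re q * t| <= e.
  move=> tab; have := Hg t (Hr _ tab) tab; apply: le_trans.
  have -> : Re (g t) - Re p - Re q * t = Re (g t - p - q * t%:C%C).
    by case: (g t) => ? ?; case: (p) => ? ?; case: (q) => ? ? /=; ring.
  exact: Re_le_normc.
have E2 t : a <= t <= b -> `|Im (g t) - Im p - Im q * t| <= e.
  move=> tab; have := Hg t (Hr _ tab) tab; apply: le_trans.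
  have -> : Im (g t) - Im p - Im q * t = Im (g t - p - q * t%:C%C).
    by case: (g t) => ? ?; case: (p) => ? ?; case: (q) => ? ? /=; ring.
  exact: Im_le_normc.
have D1 t : a <= t <= b -> is_derive t 1 G1 (Re (g t)) by move=> /Hr /dG1.
have D2 t : a <= t <= b -> is_derive t 1 G2 (Im (g t)) by move=> /Hr /dG2.
have := primitive_affine_bound ab D1 E1; have := primitive_affine_bound ab D2 E2.
move=> H2 H1; apply: le_trans (normc_le_ReIm _) _.
rewrite [`|b - a|]ger0_norm ?subr_ge0 //.
have -> : 2 * e * (b - a) = e * (b - a) + e * (b - a) by ring.
apply: lerD; [apply: le_trans H1|apply: le_trans H2]; rewrite le_eqVlt; apply/orP; left;
    apply/eqP; congr `| _ |;
by case: (p) => ? ?; case: (q) => ? ? /=; ring.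
Qed.

End Goursat.

Section Rectangle.
Context {R : realType}.
Implicit Types (f : CC R -> CC R) (w : CC R).

Lemma continuous_ReIm_comp (f : CC R -> CC R) (c : R -> CC R) (t : R) :
  (forall s s', normc (c s - c s') <= `|s - s'|) ->
  {for c t, continuous f} ->
  {for t, continuous (fun s => Re (f (c s)))} /\
  {for t, continuous (fun s => Im (f (c s)))}.
Proof.
move=> cL /cts_normcP fc.
split; apply/cvgrPdist_lt => e /fc[d d0 dP]; near=> s;
  (have : normc (f (c s) - f (c t)) < e;
    [apply: dP; apply: le_lt_trans (cL _ _) _; rewrite distrC; near: s; exact: cvgr_dist_lt|]);
  apply: le_lt_trans; rewrite distrC.
- by rewrite -ReN -ReD; apply: Re_le_normc.
- by rewrite -ImN -ImD; apply: Im_le_normc.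
Unshelve. all: by end_near. Qed.

Lemma line_integral_exists f (c : R -> CC R) r s : r < s ->
  (forall t t', normc (c t - c t') <= `|t - t'|) ->
  (forall t, `|t| < s -> {for c t, continuous f}) ->
  exists G, line_integral r (f \o c) G.
Proof.
move=> rs cL fc; apply: (line_primitive rs) => t /fc ft.
  exact: (continuous_ReIm_comp cL ft).1.
exact: (continuous_ReIm_comp cL ft).2.
Qed.

Let ic : CC R := Complex 0 1.

(** Counterclockwise contour integral; [HI y] and [VI x] are antiderivatives along a horizontal and
    a vertical line, and [ic] comes from [dz = i dy]. *)
Definition rect_integral (HI VI : R -> R -> CC R) (x0 x1 y0 y1 : R) : CC R :=
  HI y0 x1 - HI y0 x0 + ic * (VI x1 y1 - VI x1 y0)
  - (HI y1 x1 - HI y1 x0) - ic * (VI x0 y1 - VI x0 y0).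

Variables (f : CC R -> CC R) (r : R) (HI VI : R -> R -> CC R).
Hypothesis HIf : forall y, `|y| < r -> line_integral r (fun t => f (Complex t y)) (HI y).
Hypothesis VIf : forall x, `|x| < r -> line_integral r (fun t => f (Complex x t)) (VI x).
Hypothesis df : forall x y, `|x| < r -> `|y| < r -> derivable f (Complex x y : CC R) 1.

Local Notation bd := (rect_integral HI VI).

Lemma dist_itv_le (a l u v : R) : a <= u <= a + l -> a <= v <= a + l -> `|u - v| <= l.
Proof. by move=> /andP[? ?] /andP[? ?]; rewrite ler_norml; lra. Qed.

Lemma dist_between_le (x y t : R) :
  Num.min x y <= t <= Num.max x y -> `|t - x| <= `|y - x|.
Proof.
have [xy|yx] := lerP x y => /andP[? ?].
  by rewrite !ger0_norm; lra.
by rewrite !ler0_norm; lra.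
Qed.

(** The contour integral of an affine function is exactly 0, so only the deviation counts: at most
    [2 * e] times the length of each of the four sides. *)
Lemma rect_integral_affine x0 x1 y0 y1 (p q : CC R) e :
  `|x0| < r -> `|x1| < r -> `|y0| < r -> `|y1| < r -> x0 <= x1 -> y0 <= y1 ->
  (forall x y, x0 <= x <= x1 -> y0 <= y <= y1 ->
    normc (f (Complex x y) - p - q * Complex x y) <= e) ->
  normc (bd x0 x1 y0 y1) <= 4 * e * ((x1 - x0) + (y1 - y0)).
Proof.
move=> x0r x1r y0r y1r x01 y01 He.
have H y : `|y| < r -> y0 <= y <= y1 ->
  normc (HI y x1 - HI y x0 - (p + q * Complex 0 y) * (x1 - x0)%:C%C - q * ((x1 ^+ 2 - x0 ^+
      2) / 2)%:C%C) <= 2 * e * (x1 - x0).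
  move=> yr yy; have -> : 2 * e * (x1 - x0) = 2 * e * `|x1 - x0| by rewrite ger0_norm ?subr_ge0.
  apply: (HIf yr) => // t tr; rewrite (min_idPl x01) (max_idPr x01) => tt.
  have := He t y tt yy; congr (normc _ <= _).
  have -> : (Complex t y : CC R) = t%:C%C + Complex 0 y by congr Complex => /=; ring.
  ring.
have V x : `|x| < r -> x0 <= x <= x1 ->
  normc (VI x y1 - VI x y0 - (p + q * x%:C%C) * (y1 - y0)%:C%C - (q * ic) * ((y1 ^+ 2 - y0 ^+
      2) / 2)%:C%C) <= 2 * e * (y1 - y0).
  move=> xr xx; have -> : 2 * e * (y1 - y0) = 2 * e * `|y1 - y0| by rewrite ger0_norm ?subr_ge0.
  apply: (VIf xr) => // t tr; rewrite (min_idPl y01) (max_idPr y01) => tt.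
  have := He x t xx tt; congr (normc _ <= _).
  have -> : (Complex x t : CC R) = x%:C%C + ic * t%:C%C by congr Complex => /=; ring.
  ring.
have H0 := H y0 y0r ltac:(by rewrite lexx y01).
have H1 := H y1 y1r ltac:(by rewrite lexx y01).
have V0 := V x0 x0r ltac:(by rewrite lexx x01).
have V1 := V x1 x1r ltac:(by rewrite lexx x01).
move: H0 H1 V0 V1; set h0 := (X in normc X <= _ -> _); set h1 := (X in _ -> normc X <= _ -> _
    -> _).
set v0 := (X in _ -> _ -> normc X <= _ -> _); set v1 := (X in _ -> _ -> _ -> normc X <= _ -> _).
move=> H0 H1 V0 V1.
have -> : bd x0 x1 y0 y1 = h0 - h1 + ic * (v1 - v0).
  rewrite /rect_integral /h0 /h1 /v0 /v1.
  have E y : (Complex 0 y : CC R) = ic * y%:C%C by congr Complex => /=; ring.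
  rewrite !E !rmorphB /=; ring.
apply: le_trans (normcD _ _) _; rewrite Normc.normcM.
have -> : normc ic = 1 by rewrite /ic /= expr0n add0r expr1n sqrtr1.
have := normcD h0 (- h1); have := normcD v1 (- v0); rewrite !normcN; lra.
Qed.

(** The inner edges cancel, so the integral is the sum over the four quarters, and one of them
    carries at least a fourth of its norm. *)
Lemma rect_integral_quarter x0 x1 y0 y1 : x0 <= x1 -> y0 <= y1 ->
  exists a b, [/\ x0 <= a, y0 <= b,
    a + (x1 - x0) / 2 <= x1, b + (y1 - y0) / 2 <= y1 &
    normc (bd x0 x1 y0 y1) <= 4 * normc (bd a (a + (x1 - x0) / 2) b (b + (y1 - y0) / 2))].
Proof.
move=> x01 y01; set W := (x1 - x0) / 2; set H := (y1 - y0) / 2.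
have xE : x1 = x0 + W + W by rewrite /W; field.
have yE : y1 = y0 + H + H by rewrite /H; field.
have W0 : 0 <= W by rewrite /W; lra.
have H0 : 0 <= H by rewrite /H; lra.
pose B a b := bd a (a + W) b (b + H).
have S : bd x0 x1 y0 y1 = B x0 y0 + B (x0 + W) y0 + B x0 (y0 + H) + B (x0 + W) (y0 + H).
  by rewrite /B -xE -yE /rect_integral; ring.
apply: contrapT => /forallNP N.
have N' a b : x0 <= a -> y0 <= b -> a + W <= x1 -> b + H <= y1 ->
  normc (B a b) < normc (bd x0 x1 y0 y1) / 4.
  move=> *; rewrite ltNge; apply/negP => L; apply: (N a); exists b; split=> //.
  by rewrite -/(B a b); lra.
have N1 := N' x0 y0; have N2 := N' (x0 + W) y0; have N3 := N' x0 (y0 + H).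
have N4 := N' (x0 + W) (y0 + H).
have : normc (bd x0 x1 y0 y1) < normc (bd x0 x1 y0 y1).
  rewrite {1}S; apply: le_lt_trans (normcD _ _) _.
  have := normcD (B x0 y0 + B (x0 + W) y0) (B x0 (y0 + H)).
  have := normcD (B x0 y0) (B (x0 + W) y0).
  have {}N1 : normc (B x0 y0) < normc (bd x0 x1 y0 y1) / 4 by apply: N1; lra.
  have {}N2 : normc (B (x0 + W) y0) < normc (bd x0 x1 y0 y1) / 4 by apply: N2; lra.
  have {}N3 : normc (B x0 (y0 + H)) < normc (bd x0 x1 y0 y1) / 4 by apply: N3; lra.
  have {}N4 : normc (B (x0 + W) (y0 + H)) < normc (bd x0 x1 y0 y1) / 4 by apply: N4; lra.
  lra.
by rewrite ltxx.
Qed.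

Lemma rect_integral0 x0 x1 y0 y1 :
  `|x0| < r -> `|x1| < r -> `|y0| < r -> `|y1| < r -> x0 <= x1 -> y0 <= y1 ->
  bd x0 x1 y0 y1 = 0.
Proof.
move=> x0r x1r y0r y1r x01 y01; apply/eqP; rewrite -normc_eq0; apply: contraT => c0.
pose c := normc (bd x0 x1 y0 y1).
have {}c0 : 0 < c by rewrite lt_def c0 normc_ge0.
pose W n := (x1 - x0) / 2 ^+ n; pose H n := (y1 - y0) / 2 ^+ n.
have WS n : W n / 2 = W n.+1 by rewrite /W exprSr invfM mulrA.
have HS n : H n / 2 = H n.+1 by rewrite /H exprSr invfM mulrA.
have W0 n : 0 <= W n by rewrite divr_ge0 ?subr_ge0 ?exprn_ge0.
have H0 n : 0 <= H n by rewrite divr_ge0 ?subr_ge0 ?exprn_ge0.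
have step (n : nat) (q : R * R) : exists q' : R * R,
  [/\ q.1 <= q'.1, q.2 <= q'.2, q'.1 + W n.+1 <= q.1 + W n, q'.2 + H n.+1 <= q.2 + H n &
   normc (bd q.1 (q.1 + W n) q.2 (q.2 + H n)) <=
     4 * normc (bd q'.1 (q'.1 + W n.+1) q'.2 (q'.2 + H n.+1))].
  have [||a [b]] := @rect_integral_quarter q.1 (q.1 + W n) q.2 (q.2 + H n).
  - by rewrite lerDl.
  - by rewrite lerDl.
  - have -> : q.1 + W n - q.1 = W n by ring.
    have -> : q.2 + H n - q.2 = H n by ring.
    by rewrite WS HS => *; exists (a, b).
have [nxt nxtP] := choice (fun p : nat * (R * R) => step p.1 p.2).
pose q := fix q n := if n is m.+1 then nxt (m, q m) else (x0, y0).
have qS n := nxtP (n, q n); rewrite /= -/(q _.+1) in qS.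
have Wn : 0 < W 0 + H 0 + 1 by rewrite ltr_wpDl // addr_ge0.
have mx m n : (m <= n)%N -> (q m).1 <= (q n).1 /\ (q n).1 + W n <= (q m).1 + W m.
  elim: n => [|n IH]; first by rewrite leqn0 => /eqP ->.
  rewrite leq_eqVlt => /orP[/eqP -> //|]; rewrite ltnS => /IH [A B].
  by have [C _ D _ _] := qS n; split; [apply: le_trans C|apply: le_trans D _].
have my m n : (m <= n)%N -> (q m).2 <= (q n).2 /\ (q n).2 + H n <= (q m).2 + H m.
  elim: n => [|n IH]; first by rewrite leqn0 => /eqP ->.
  rewrite leq_eqVlt => /orP[/eqP -> //|]; rewrite ltnS => /IH [A B].
  by have [_ C _ D _] := qS n; split; [apply: le_trans C|apply: le_trans D _].
(* Nested intervals: the supremum of the left ends lies below every right end. *)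
have lim (u V : nat -> R) : (forall m n, u m <= V n) -> exists t, forall n, u n <= t <= V n.
  move=> uV; exists (sup (range u)) => n.
  have ne : range u !=set0 by exists (u 0%N); exists 0%N.
  have ub : has_ubound (range u) by exists (V 0%N) => _ [m _ <-].
  by apply/andP; split; [apply: ub_le_sup => //; exists n|apply: ge_sup => // _ [m _ <-]].
have [x xP] : exists t, forall n, (q n).1 <= t <= (q n).1 + W n.
  apply: lim => m n; case: (leqP m n) => mn.
    by apply: le_trans (mx m n mn).1 _; rewrite lerDl.
  by apply: le_trans (mx n m (ltnW mn)).2; rewrite lerDl.
have [y yP] : exists t, forall n, (q n).2 <= t <= (q n).2 + H n.
  apply: lim => m n; case: (leqP m n) => mn.
    by apply: le_trans (my m n mn).1 _; rewrite lerDl.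
  by apply: le_trans (my n m (ltnW mn)).2; rewrite lerDl.
have qx n : x0 <= (q n).1 /\ (q n).1 + W n <= x1.
  have [A B] := mx 0%N n (leq0n n); split=> //.
  by move: B; rewrite /= /W expr0; lra.
have qy n : y0 <= (q n).2 /\ (q n).2 + H n <= y1.
  have [A B] := my 0%N n (leq0n n); split=> //.
  by move: B; rewrite /= /H expr0; lra.
have xr t : x0 <= t <= x1 -> `|t| < r.
  by move: x0r x1r; rewrite !ltr_norml => /andP[? ?] /andP[? ?] /andP[? ?]; apply/andP;
      split; lra.
have yr t : y0 <= t <= y1 -> `|t| < r.
  by move: y0r y1r; rewrite !ltr_norml => /andP[? ?] /andP[? ?] /andP[? ?]; apply/andP;
      split; lra.
have xr' : `|x| < r by apply: xr; have := xP 0%N; have := qx 0%N; lra.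
have yr' : `|y| < r by apply: yr; have := yP 0%N; have := qy 0%N; lra.
have /derivableP/is_deriveCP dxy := df xr' yr'.
(* The [n]-th rectangle contributes at most [4 * e * (L / 2^n)^2]; multiplied by [4^n] this is
   [4 * e * L^2 = c / 2 < c]. The summand 1 keeps [L] positive for degenerate rectangles. *)
pose L := W 0 + H 0 + 1; pose e := c / (8 * L ^+ 2).
have L2 : 0 < L ^+ 2 by rewrite exprn_gt0.
have e0 : 0 < e by rewrite divr_gt0 // mulr_gt0.
have [d d0 dP] := dxy e e0.
have [n nP] : exists n, L / 2 ^+ n < d.
  have /archi_boundP := (ltW (divr_gt0 Wn d0)); set n := Num.bound _ => nP.
  exists n; rewrite ltr_pdivrMr ?exprn_gt0 // mulrC -ltr_pdivrMr //.
  apply: lt_trans nP _; rewrite -natrX ltr_nat; exact: ltn_expl.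
have cn : c <= 4 ^+ n * normc (bd (q n).1 ((q n).1 + W n) (q n).2 ((q n).2 + H n)).
  elim: (n) => [|k IH].
    rewrite expr0 mul1r /=; have -> : x0 + W 0 = x1 by rewrite /W expr0; field.
    by have -> : y0 + H 0 = y1 by rewrite /H expr0; field.
  apply: le_trans IH _; have [_ _ _ _] := qS k.
  by rewrite exprSr -mulrA ler_pM2l ?exprn_gt0.
have [A B] := qx n; have [A' B'] := qy n.
have WLn : W n + H n <= L / 2 ^+ n.
  rewrite /L /W /H expr0 !divr1 -mulrDl ler_pM2r ?invr_gt0 ?exprn_gt0 //; lra.
pose l : CC R := 'D_1 f (Complex x y : CC R).
have key : normc (bd (q n).1 ((q n).1 + W n) (q n).2 ((q n).2 + H n)) <=
   4 * (e * (L / 2 ^+ n)) * (((q n).1 + W n - (q n).1) + ((q n).2 + H n - (q n).2)).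
  (* The comparison function is the first-order expansion of [f] at the common point of the
     rectangles. *)
  apply: (rect_integral_affine (p := f (Complex x y) - l * Complex x y) (q := l)).
  - by apply: xr; have := W0 n; lra.
  - by apply: xr; have := W0 n; lra.
  - by apply: yr; have := H0 n; lra.
  - by apply: yr; have := H0 n; lra.
  - by rewrite lerDl.
  - by rewrite lerDl.
  move=> u v un vn; have := xP n; have := yP n => yn xn.
  pose h : CC R := Complex u v - Complex x y.
  have hs : normc h <= L / 2 ^+ n.
    apply: le_trans (normc_le_ReIm _) _; apply: le_trans WLn.
        by apply: lerD; [exact: (dist_itv_le un xn)|exact: (dist_itv_le vn yn)].
  have := dP h (le_lt_trans hs nP).
  have -> : (Complex x y : CC R) + h = Complex u v by rewrite /h addrC subrK.
  rewrite -/l => Q; apply: (@le_trans _ _ (e * normc h)); last by rewrite ler_pM2l.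
  by move: Q; congr (normc _ <= _); rewrite /h; ring.
have : c < c; last by rewrite ltxx.
apply: le_lt_trans cn _.
have : normc (bd (q n).1 ((q n).1 + W n) (q n).2 ((q n).2 + H n)) <= 4 * (e * (L / 2 ^+ n)) *
    (L / 2 ^+ n).
  apply: le_trans key _; apply: ler_wpM2l.
    by rewrite mulr_ge0 // mulr_ge0 ?(ltW e0) // divr_ge0 ?(ltW Wn) // exprn_ge0.
  by apply: le_trans WLn; lra.
move=> key2; have P4 : 0 < 4 ^+ n :> R by rewrite exprn_gt0.
apply: (@le_lt_trans _ _ (4 ^+ n * (4 * (e * (L / 2 ^+ n)) * (L / 2 ^+ n)))).
  by rewrite ler_pM2l.
have -> : 4 ^+ n = 2 ^+ n * 2 ^+ n :> R by rewrite -exprMn; congr (_ ^+ _); ring.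
have P2 : 2 ^+ n != 0 :> R by rewrite expf_neq0.
have -> : 2 ^+ n * 2 ^+ n * (4 * (e * (L / 2 ^+ n)) * (L / 2 ^+ n)) = 4 * e * L ^+ 2 by field.
have -> : 4 * e * L ^+ 2 = c / 2 by rewrite /e; field; exact: lt0r_neq0.
lra.
Qed.

(** Exchanging the ends of a side only changes the sign of the contour integral. *)
Lemma rect_integral_eq0 x0 x1 y0 y1 :
  `|x0| < r -> `|x1| < r -> `|y0| < r -> `|y1| < r -> bd x0 x1 y0 y1 = 0.
Proof.
move=> x0r x1r y0r y1r.
wlog x01 : x0 x1 x0r x1r / x0 <= x1 => [H|].
  case/orP: (le_total x0 x1) => [|/H]; first exact: H.
  move=> /(_ x1r x0r) E; rewrite -[LHS]opprK; apply/eqP; rewrite oppr_eq0; apply/eqP.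
  by rewrite -[RHS]E /rect_integral; ring.
wlog y01 : y0 y1 y0r y1r / y0 <= y1 => [H|]; last exact: rect_integral0.
case/orP: (le_total y0 y1) => [|/H]; first exact: H.
move=> /(_ y1r y0r) E; rewrite -[LHS]opprK; apply/eqP; rewrite oppr_eq0; apply/eqP.
by rewrite -[RHS]E /rect_integral; ring.
Qed.

Lemma primitive_of_line_integrals : exists P : CC R -> CC R,
  forall w, `|Re w| < r -> `|Im w| < r -> is_derive w (1 : CC R) P (f w).
Proof.
(* Integration from 0 along the real axis, then vertically up to [w]. *)
exists (fun w => HI 0 (Re w) - HI 0 0 + ic * (VI (Re w) (Im w) - VI (Re w) 0)).
case=> x y /= xr yr; have r0 : `|0 : R| < r by rewrite normr0; apply: le_lt_trans xr.
have /derivableP/is_derive_cts/cts_normcP fc := df xr yr.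
apply/is_deriveCP => e e0; have e40 : 0 < e / 4 by rewrite divr_gt0.
have [d d0 dP] := fc _ e40.
pose d1 := Num.min d (Num.min (r - `|x|) (r - `|y|)).
exists d1; first by rewrite !lt_min d0 !subr_gt0 xr yr.
case=> h k; set hk : CC R := Complex h k; rewrite !lt_min => /and3P[hd hx hy].
have hh : `|h| <= normc hk := Re_le_normc hk; have kk : `|k| <= normc hk := Im_le_normc hk.
have x'r : `|x + h| < r by apply: le_lt_trans (ler_normD _ _) _; lra.
have y'r : `|y + k| < r by apply: le_lt_trans (ler_normD _ _) _; lra.
(* The vanishing over the rectangle between heights 0 and [y] replaces the increment by an integral
   over two short sides near the point, where continuity of [f] controls it. *)
have E : HI 0 (x + h) - HI 0 0 + ic * (VI (x + h) (y + k) - VI (x + h) 0) -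
   (HI 0 x - HI 0 0 + ic * (VI x y - VI x 0)) =
   (HI y (x + h) - HI y x) + ic * (VI (x + h) (y + k) - VI (x + h) y).
  by have := rect_integral_eq0 xr x'r r0 yr; rewrite /rect_integral => B; apply/eqP; rewrite
      -subr_eq0 -B; apply/eqP; ring.
rewrite /= E.
have A1 : normc (HI y (x + h) - HI y x - f (Complex x y) * (x + h - x)%:C%C - 0 * (((x + h)
    ^+ 2 - x ^+ 2) / 2)%:C%C) <= 2 * (e / 4) * `|x + h - x|.
  apply: (HIf yr) => // t tr tt; rewrite mul0r subr0; apply/ltW/dP.
  apply: le_lt_trans hd; apply: le_trans (normc_le_ReIm _) _ => /=.
  rewrite subrr normr0 addr0; apply: le_trans hh.
  by have := dist_between_le tt; have -> : x + h - x = h by ring.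
have A2 : normc (VI (x + h) (y + k) - VI (x + h) y - f (Complex x y) * (y + k - y)%:C%C - 0 *
    (((y + k) ^+ 2 - y ^+ 2) / 2)%:C%C) <= 2 * (e / 4) * `|y + k - y|.
  apply: (VIf x'r) => // t tr tt; rewrite mul0r subr0; apply/ltW/dP.
  apply: le_lt_trans hd; rewrite /normc /hk /= ler_sqrt ?addr_ge0 ?sqr_ge0 //.
  have -> : x + h - x = h by ring.
  rewrite lerD2l -(real_normK (num_real (t - y))) -(real_normK (num_real k)) ler_sqr ?nnegrE //.
  by have := dist_between_le tt; have -> : y + k - y = k by ring.
move: A1 A2; rewrite !mul0r !subr0.
have -> : x + h - x = h by ring. have -> : y + k - y = k by ring.
set a1 := (X in normc X <= _ -> _); set a2 := (X in _ -> normc X <= _ -> _) => A1 A2.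
have -> : HI y (x + h) - HI y x + ic * (VI (x + h) (y + k) - VI (x + h) y) - f (Complex x y)
    * hk = a1 + ic * a2.
  rewrite /a1 /a2; have -> : hk = h%:C%C + ic * k%:C%C by congr Complex => /=; ring.
  ring.
apply: le_trans (normcD _ _) _; rewrite Normc.normcM.
have -> : normc ic = 1 by rewrite /ic /= expr0n add0r expr1n sqrtr1.
have : e * `|h| <= e * normc hk by rewrite ler_pM2l.
have : e * `|k| <= e * normc hk by rewrite ler_pM2l.
move=> Q1 Q2; change (normc a1 + 1 * normc a2 <= e * normc hk); lra.
Qed.

End Rectangle.

Lemma holomorphic_primitive (R : realType) (f : CC R -> CC R) (r s : R) : r < s ->
  (forall w : CC R, `|Re w| < s -> `|Im w| < s -> derivable f w 1) ->
  exists P : CC R -> CC R,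
    forall w : CC R, `|Re w| < r -> `|Im w| < r -> is_derive w (1 : CC R) P (f w).
Proof.
move=> rs df.
have fc (w : CC R) : `|Re w| < s -> `|Im w| < s -> {for w, continuous f}.
  by move=> ws ws'; have /derivableP/is_derive_cts := df w ws ws'.
have HX y : exists G, `|y| < r -> line_integral r (fun t => f (Complex t y)) G.
  have [yr|_] := boolP (`|y| < r); last by exists 0.
  have [||G ?] := @line_integral_exists R f (fun t => Complex t y) r s rs; last by exists G.
    move=> t t'; apply: le_trans (normc_le_ReIm _) _; by rewrite /= subrr normr0 addr0.
  by move=> t ts; apply: fc => //=; apply: lt_trans rs.
have VX x : exists G, `|x| < r -> line_integral r (fun t => f (Complex x t)) G.
  have [xr|_] := boolP (`|x| < r); last by exists 0.
  have [||G ?] := @line_integral_exists R f (fun t => Complex x t) r s rs; last by exists G.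
    move=> t t'; apply: le_trans (normc_le_ReIm _) _; by rewrite /= subrr normr0 add0r.
  by move=> t ts; apply: fc => //=; apply: lt_trans rs.
have [HI HIP] := choice HX; have [VI VIP] := choice VX.
apply: (primitive_of_line_integrals HIP VIP) => x y xr yr.
by apply: df => /=; apply: lt_trans rs.
Qed.

(** * Identity theorem *)

Section Identity.
Context {R : realType}.
Implicit Types (a w h l : CC R) (f g P H : CC R -> CC R).

Lemma normc_sqr w : normc w ^+ 2 = Re w ^+ 2 + Im w ^+ 2.
Proof. by case: w => x y /=; rewrite sqr_sqrtr // addr_ge0 ?sqr_ge0. Qed.

Lemma is_derive_small (g : R -> R) (a l : R) :
  (forall e : R, 0 < e -> exists2 d : R, 0 < d & forall h : R,
    `|h| < d -> `|g (a + h) - g a - l * h| <= e * `|h|) ->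
  is_derive a 1 g l.
Proof.
move=> gl.
have lim : (fun h : R => h^-1 *: (g (h *: (1 : R) + a) - g a)) @ 0^' --> l.
  apply/cvgrPdist_le => e /gl[d d0 dP]; rewrite /dnbhs near_withinE.
  apply/nbhs_ballP; exists d => // h; rewrite /ball /= sub0r normrN => hd h0.
  rewrite distrC; have := dP h hd; rewrite -ler_pdivrMr ?normr_gt0 // -normfV -normrM.
  by congr (`| _ | <= _); rewrite /GRing.scale /= mulr1 [h + a]addrC; field.
apply: DeriveDef; first by apply/cvg_ex; exists l.
exact/cvg_lim.
Qed.

(** Here [k] stands for [Re] or [Im]: a real-linear functional of norm at most 1 turns a complex
    derivative into a real one along a ray. *)
Lemma is_derive_ray g l a h (s : R) (k : CC R -> R) :
  (forall w w', k (w - w') = k w - k w') ->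
  (forall (x : R) w, k (w * x%:C%C) = k w * x) -> (forall w, `|k w| <= normc w) ->
  is_derive (a + s%:C%C * h : CC R) (1 : CC R) g l ->
  is_derive s 1 (fun s : R => k (g (a + s%:C%C * h))) (k (l * h)).
Proof.
move=> kB kZ kle /is_deriveCP gl; apply: is_derive_small => e e0.
have M0 : 0 < normc h + 1 by have := normc_ge0 h; lra.
have [d d0 dP] := gl (e / (normc h + 1)) (divr_gt0 e0 M0).
exists (d / (normc h + 1)) => [|x xd]; first exact: divr_gt0.
have xh : normc (x%:C%C * h) <= `|x| * (normc h + 1).
  by rewrite Normc.normcM normc_real ler_wpM2l // lerDl.
have /dP : normc (x%:C%C * h) < d by apply: le_lt_trans xh _; rewrite -ltr_pdivlMr.
have -> : a + (s + x)%:C%C * h = a + s%:C%C * h + x%:C%C * h by rewrite rmorphD mulrDl addrA.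
have -> : l * (x%:C%C * h) = l * h * x%:C%C by ring.
move=> Q; rewrite -kZ -!kB; apply: le_trans (kle _) _; apply: le_trans Q _.
rewrite -mulrA ler_pM2l // mulrC ler_pdivrMr //.
Qed.

(** The real mean value theorem is applied to [Re] and [Im] along the segment, possibly at different
    points; hence the factor 2. *)
Lemma mean_value_bound g g' a h M :
  (forall w, normc (w - a) <= normc h -> is_derive w (1 : CC R) g (g' w)) ->
  (forall w, normc (w - a) <= normc h -> normc (g' w) <= M) ->
  normc (g (a + h) - g a) <= 2 * M * normc h.
Proof.
move=> dg gM.
have inr (s : R) : 0 <= s <= 1 -> normc (a + s%:C%C * h - a) <= normc h.
  move=> /andP[s0 s1]; rewrite addrAC subrr add0r Normc.normcM normc_real ger0_norm //.
  by rewrite ler_piMl // normc_ge0.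
have bound (k : CC R -> R) : (forall w w', k (w - w') = k w - k w') ->
  (forall (x : R) w, k (w * x%:C%C) = k w * x) -> (forall w, `|k w| <= normc w) ->
  `|k (g (a + h) - g a)| <= M * normc h.
  move=> kB kZ kle; pose u (s : R) := k (g (a + s%:C%C * h)).
  have du (s : R) : 0 <= s <= 1 -> is_derive s 1 u (k (g' (a + s%:C%C * h) * h)).
    by move=> s01; apply: (is_derive_ray kB kZ kle); exact/dg/inr.
  have du' (s : R) : s \in `]0, 1[ -> is_derive s 1 u (k (g' (a + s%:C%C * h) * h)).
    by rewrite in_itv /= => /andP[s0 s1]; apply: du; rewrite !ltW.
  have cu : {within `[0, 1], continuous u}.
    apply: continuous_in_subspaceT => x; rewrite inE /= in_itv /= => xab.
    by apply/differentiable_continuous/derivable1_diffP; have [] := du x xab.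
  have [s] := MVT_segment ler01 du' cu; rewrite in_itv /= => s01.
  rewrite /u rmorph1 mul1r rmorph0 mul0r addr0 subr0 mulr1 kB => ->.
  apply: le_trans (kle _) _; rewrite Normc.normcM ler_wpM2r ?normc_ge0 //.
  exact/gM/inr.
apply: le_trans (normc_le_ReIm _) _.
have -> : 2 * M * normc h = M * normc h + M * normc h by ring.
apply: lerD; apply: bound.
- by move=> w w'; rewrite ReD ReN.
- by move=> x w; rewrite ReM /= mulr0 subr0.
- exact: Re_le_normc.
- by move=> w w'; rewrite ImD ImN.
- by move=> x w; rewrite ImM /= mulr0 add0r.
- exact: Im_le_normc.
Qed.

Lemma is_derive_quadratic a b l h :
  is_derive (h : CC R) (1 : CC R) (fun h : CC R => b * (h - a) + l / 2 * (h - a) ^+ 2) (b + l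
      * (h - a)).
Proof.
apply/is_deriveCP => e e0; exists (e / (normc l + 1)).
  by rewrite divr_gt0 // ltr_wpDl // normc_ge0.
move=> k kd.
have -> : b * (h + k - a) + l / 2 * (h + k - a) ^+ 2 - (b * (h - a) + l / 2 * (h - a) ^+ 2) -
  (b + l * (h - a)) * k = l * (2^-1)%:C%C * k * k.
  have -> : (2^-1)%:C%C = 2^-1 :> CC R by rewrite fmorphV rmorph_nat.
  by field.
have L0 := normc_ge0 l; have K0 := normc_ge0 k.
rewrite !Normc.normcM normc_real ler_wpM2r //.
rewrite ger0_norm ?invr_ge0 //; move: kd; rewrite ltr_pdivlMr ?ltr_wpDl // => kd.
nra.
Qed.

(** Subtracting the quadratic Taylor polynomial from [P] leaves a function whose derivative is the
    first-order error of [f]; the mean value bound then gains one power of [h]. *)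
Lemma second_order_expansion P f a l r : 0 < r ->
  (forall w, normc (w - a) < r -> is_derive w (1 : CC R) P (f w)) ->
  is_derive a (1 : CC R) f l ->
  forall e : R, 0 < e -> exists2 d : R, 0 < d & forall h, normc h < d ->
    normc (P (a + h) - P a - f a * h - l / 2 * h ^+ 2) <= e * normc h ^+ 2.
Proof.
move=> r0 dP /is_deriveCP fl e e0; have e20 : 0 < e / 2 by rewrite divr_gt0.
have [d d0 dfP] := fl _ e20; exists (Num.min d r); first by rewrite lt_min d0.
move=> h; rewrite lt_min => /andP[hd hr].
pose g w := P w - (f a * (w - a) + l / 2 * (w - a) ^+ 2).
pose g' w := f w - (f a + l * (w - a)).
have dg w : normc (w - a) < r -> is_derive w (1 : CC R) g (g' w).
  move=> /dP dPw; have dq := is_derive_quadratic a (f a) l w.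
  exact: is_deriveB.
have -> : P (a + h) - P a - f a * h - l / 2 * h ^+ 2 = g (a + h) - g a.
  by rewrite /g subrr mulr0 expr0n mulr0 addr0 subr0 [a + h]addrC addrK; ring.
have -> : e * normc h ^+ 2 = 2 * (e / 2 * normc h) * normc h by field.
apply: (@mean_value_bound g g') => w wh; first exact/dg/(le_lt_trans wh).
have := dfP (w - a) (le_lt_trans wh hd); rewrite [a + _]addrC subrK => Q.
by rewrite /g' opprD addrA; apply: le_trans Q _; rewrite ler_pM2l.
Qed.

(** In the directions [t, -t, it, -it] the linear terms cancel in pairs, and the quadratic ones
    because [(it)^2 = - t^2]: a discrete Laplacian that vanishes to order [o(t^2)]. *)
Lemma four_point P f a l r : 0 < r ->
  (forall w, normc (w - a) < r -> is_derive w (1 : CC R) P (f w)) ->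
  is_derive a (1 : CC R) f l ->
  forall e : R, 0 < e -> exists2 d : R, 0 < d & forall t : R, 0 < t < d ->
    normc (P (a + t%:C%C) + P (a - t%:C%C) + P (a + Complex 0 t) + P (a - Complex 0 t)
      - 4 * P a) <= e * t ^+ 2.
Proof.
move=> r0 dP fl e e0; have e40 : 0 < e / 4 by rewrite divr_gt0.
have [d d0 D] := second_order_expansion r0 dP fl e40; exists d => // t /andP[t0 td].
have n1 : normc t%:C%C = t by rewrite normc_real gtr0_norm.
have n2 : normc (Complex 0 t) = t by rewrite /= expr0n add0r sqrtr_sqr gtr0_norm.
have D1 := D t%:C%C; have D2 := D (- t%:C%C); have D3 := D (Complex 0 t); have D4 := D (-
    Complex 0 t).
rewrite !normcN n1 n2 in D1 D2 D3 D4.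
have {}D1 := D1 td; have {}D2 := D2 td; have {}D3 := D3 td; have {}D4 := D4 td.
move: D1 D2 D3 D4.
have cE : (Complex 0 t : CC R) = Complex 0 1 * t%:C%C by congr Complex => /=; ring.
have iE : (Complex 0 1 : CC R) ^+ 2 = -1 by rewrite expr2; congr Complex => /=; ring.
rewrite !cE !sqrrN !exprMn iE.
set A1 := (X in normc X <= _ -> _); set A2 := (X in _ -> normc X <= _ -> _).
set A3 := (X in _ -> _ -> normc X <= _ -> _); set A4 := (X in _ -> _ -> _ -> normc X <= _ -> _).
move=> D1 D2 D3 D4.
set S := (X in normc X <= _); have -> : S = (A1 + A2) + (A3 + A4).
  by rewrite /S /A1 /A2 /A3 /A4; ring.
apply: le_trans (normcD _ _) _.
have := normcD A1 A2; have := normcD A3 A4; lra.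
Qed.

End Identity.

(** * A maximum principle and the identity theorem on a disc *)

Section MaximumPrinciple.
Context {R : realType}.
Implicit Types (a w h l : CC R) (f g P H : CC R -> CC R).

Lemma plane_to_CC_continuous : continuous (@plane_to_CC R).
Proof.
move=> p; apply/cvg_normcP => e e0.
have e20 : 0 < e / 2 by rewrite divr_gt0.
exists (ball p.1 (e / 2), ball p.2 (e / 2)) => [|q [/= q1 q2]].
  by split; exact: nbhsx_ballx.
change (normc (plane_to_CC q - plane_to_CC p) < e).
apply: le_lt_trans (normc_le_ReIm _) _ => /=.
move: q1 q2; rewrite /ball /= [`|p.1 - _|]distrC [`|p.2 - _|]distrC; lra.
Qed.

Lemma normc_continuous : continuous (fun w : CC R => normc w).
Proof.
move=> w P /nbhs_ballP[e e0 eP]; apply/nbhs_normcP; exists e => // z zw.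
by apply: eP; rewrite /ball /= distrC; apply: le_lt_trans zw; exact: normc_dist.
Qed.

Lemma disc_compact (r : R) : compact [set p : R * R | normc (plane_to_CC p) <= r].
Proof.
have cc : continuous (fun p : R * R => normc (plane_to_CC p)).
  by move=> p; exact: continuous_comp (@plane_to_CC_continuous p) (@normc_continuous _).
apply: (@subclosed_compact _ _ (`[- r, r] `*` `[- r, r])).
- by move/continuous_closedP : cc => /(_ _ (@closed_le _ r)).
- by apply: compact_setX; exact: segment_compact.
- move=> [x y] /= H; rewrite !in_itv /= -!ler_norml; split.
    exact: le_trans (Re_le_normc (Complex x y)) H.
  exact: le_trans (Im_le_normc (Complex x y)) H.
Qed.

Lemma max_on_disc (v : CC R -> R) (r : R) : 0 <= r ->
  (forall w, normc w <= r -> {for w, continuous v}) ->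
  exists2 a, normc a <= r & forall w, normc w <= r -> v w <= v a.
Proof.
move=> r0 vc; pose K := [set p : R * R | normc (plane_to_CC p) <= r].
have K0 : K !=set0 by exists (0, 0); rewrite /K /= expr0n addr0 sqrtr0.
have cv : {within K, continuous (v \o plane_to_CC)}.
  apply: continuous_in_subspaceT => p; rewrite inE => pK.
  by apply: continuous_comp; [exact: plane_to_CC_continuous|exact: vc].
have [p pK pmax] := compact_EVT_max K0 (@disc_compact r) cv.
exists (plane_to_CC p); first by move: pK; rewrite inE.
move=> [x y] wr; apply: (pmax (x, y)); by rewrite inE.
Qed.

Lemma normc_sum4 a (t : R) :
  normc (a + t%:C%C) ^+ 2 + normc (a - t%:C%C) ^+ 2 + normc (a + Complex 0 t) ^+ 2
   + normc (a - Complex 0 t) ^+ 2 = 4 * normc a ^+ 2 + 4 * t ^+ 2.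
Proof. by rewrite !normc_sqr; case: a => x y /=; ring. Qed.

(* The four-point mean of [|w|^2] exceeds its value at the centre by [t^2],
   whereas that of [H] is exact up to [o(t^2)]. *)
Lemma no_interior_max H g a l (r r' e : R) : 0 < e -> 0 < r ->
  (forall w, normc (w - a) < r -> is_derive w (1 : CC R) H (g w)) ->
  is_derive a (1 : CC R) g l -> H a != 0 -> normc a < r' ->
  ~ (forall w, normc w <= r' ->
      normc (H w) + e * normc w ^+ 2 <= normc (H a) + e * normc a ^+ 2).
Proof.
move=> e0 r0 dH dh Ha0 ar' amax.
have [d d0 D] := four_point r0 dH dh e0.
pose t := Num.min (d / 2) (r' - normc a).
have t0 : 0 < t by rewrite lt_min divr_gt0 // subr_gt0.
have td : t < d by rewrite gt_min; apply/orP; left; lra.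
have tr : t <= r' - normc a by rewrite ge_min lexx orbT.
have n1 : normc t%:C%C = t by rewrite normc_real gtr0_norm.
have n2 : normc (Complex 0 t) = t by rewrite /= expr0n add0r sqrtr_sqr gtr0_norm.
have t0d : 0 < t < d by rewrite t0.
have := D t t0d.
have in_disc w : normc w = t -> normc (a + w) <= r'.
  by move=> wt; apply: le_trans (normcD _ _) _; rewrite wt; lra.
have M1 := amax _ (in_disc _ n1).
have M2 := amax (a - t%:C%C) (in_disc _ (etrans (normcN _) n1)).
have M3 := amax _ (in_disc _ n2).
have M4 := amax (a - Complex 0 t) (in_disc _ (etrans (normcN _) n2)).
have S := normc_sum4 a t.
(* The rotation [k] makes [H a] real and positive, while [Re (k * w) <= |w|] at the four neighbours,
   so the real part of the four-point estimate contradicts maximality. *)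
pose k : CC R := (H a)^-1 * (normc (H a))%:C%C.
have nHa : 0 < normc (H a) by rewrite normc_gt0.
have nk : normc k = 1.
  by rewrite /k Normc.normcM Normc.normcV normc_real ger0_norm ?normc_ge0 // mulVf ?lt0r_neq0.
have kHa : Re (k * H a) = normc (H a) by rewrite /k mulrAC mulVf // mul1r.
have kle w : Re (k * w) <= normc w.
  by apply: le_trans (ler_norm _) _; apply: le_trans (Re_le_normc _) _; rewrite Normc.normcM
      nk mul1r.
set Q := (X in normc X <= _) => QP.
have : - Re (k * Q) <= normc Q.
  by rewrite -normcN -ReN -mulrN; exact: kle.
rewrite /Q mulrBr !mulrDr ReD ReN !ReD.
have -> : Re (k * (4 * H a)) = 4 * normc (H a).
  have -> : k * (4 * H a) = k * H a + k * H a + k * H a + k * H a by ring.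
  by rewrite !ReD kHa; ring.
have := kle (H (a + t%:C%C)); have := kle (H (a - t%:C%C)).
have := kle (H (a + Complex 0 t)); have := kle (H (a - Complex 0 t)).
rewrite -/Q => K1 K2 K3 K4 K5.
have T2 : 0 < e * t ^+ 2 by rewrite mulr_gt0 // exprn_gt0.
have {}S : e * normc (a + t%:C%C) ^+ 2 + e * normc (a - t%:C%C) ^+ 2 + e * normc (a + Complex
    0 t) ^+ 2
   + e * normc (a - Complex 0 t) ^+ 2 = 4 * (e * normc a ^+ 2) + 4 * (e * t ^+ 2).
  have -> : 4 * (e * normc a ^+ 2) + 4 * (e * t ^+ 2) = e * (4 * normc a ^+ 2 + 4 * t ^+ 2)
      by ring.
  by rewrite -S; ring.
lra.
Qed.

Lemma expr_small (q e : R) : 0 <= q < 1 -> 0 < e -> exists n, q ^+ n < e.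
Proof.
move=> /andP[q0 q1] e0.
have /cvgr0Pnorm_lt /(_ e e0) [n _ nP] : (GRing.exp q) @ \oo --> (0 : R).
  by apply: cvg_expr; rewrite ger0_norm.
by exists n; have := nP n (leqnn n); rewrite ger0_norm // exprn_ge0.
Qed.

Lemma is_derive_divX P f w n : w != 0 -> is_derive w (1 : CC R) P (f w) ->
  is_derive w (1 : CC R) (fun w : CC R => P w * (w^-1) ^+ n)
    (f w * (w^-1) ^+ n - P w * (w^-1) ^+ n.+1 *+ n).
Proof.
move=> w0 dP.
have dI : is_derive w (1 : CC R) (fun w : CC R => w^-1) (- w ^- 2).
  have did : derivable (fun x : CC R => x) w (1 : CC R) := @derivable_id _ _ w 1.
  have dI := @derivableV (complex R) (CC R) (fun x : CC R => x) w 1 w0 did.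
  have dE := @deriveV (complex R) (CC R) (fun x : CC R => x) w 1 w0 did.
  by apply: DeriveDef => //; rewrite dE derive_id /GRing.scale /= mulr1.
have dX := is_deriveX n dI.
have dM := is_deriveM dP dX.
have -> : (fun w : CC R => P w * (w^-1) ^+ n) = P * (fun w : CC R => w^-1) ^+ n.
  by apply/funext => x; rewrite exprfctE.
apply: (is_derive_eq dM); rewrite /GRing.scale /= exprfctE -exprVn addrC [_ * f w]mulrC.
congr (_ + _); move: (w^-1) => v; case: n {dX dM} => [|n].
  by rewrite !mul0r mulr0 mulr0n oppr0.
by rewrite /= -[in RHS]mulr_natl !exprS; ring.
Qed.

Lemma derive_near0 P w l (r : R) : 0 < r -> is_derive w (1 : CC R) P l ->
  (forall z, normc (z - w) < r -> P z = 0) -> l = 0.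
Proof.
move=> r0 /is_deriveCP dP P0; apply/eqP; rewrite -normc_eq0; apply: contraT => l0.
have {}l0 : 0 < normc l by rewrite lt_def l0 normc_ge0.
have l20 : 0 < normc l / 2 by rewrite divr_gt0.
have [d d0 D] := dP _ l20.
pose t := Num.min d r / 2.
have m0 : 0 < Num.min d r by rewrite lt_min d0.
have m1 : Num.min d r <= d by rewrite ge_min lexx.
have m2 : Num.min d r <= r by rewrite ge_min lexx orbT.
have nt : normc t%:C%C = t by rewrite normc_real ger0_norm // /t divr_ge0 // ltW.
have td : normc t%:C%C < d by rewrite nt /t; lra.
have := D _ td; rewrite !P0.
- rewrite subrr sub0r normcN Normc.normcM nt => Q.
  have t0 : 0 < t by rewrite /t divr_gt0.
  have : 0 < normc l * t by rewrite mulr_gt0.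
  lra.
- by rewrite subrr Normc.normc0.
- by rewrite addrAC subrr add0r nt /t; lra.
Qed.

Lemma lt_of_le_half (x y z : R) : x < y -> y <= z + (y - x) / 2 -> x < z.
Proof. lra. Qed.

Theorem holomorphic_identity f (s e0 : R) : 0 < e0 ->
  (forall w, normc w < 3 * s -> derivable f w 1) ->
  (forall w, normc w < e0 -> f w = 0) ->
  forall w, normc w < s -> f w = 0.
Proof.
move=> e00 df f0.
have [s0|s0] := leP s 0.
  by move=> w /lt_le_trans /(_ s0); rewrite ltNge normc_ge0.
have [P0 dP0] : exists P : CC R -> CC R,
  forall w : CC R, `|Re w| < s -> `|Im w| < s -> is_derive w (1 : CC R) P (f w).
  (* The primitive needs an open square of half side larger than [s]; that of half side [3 / 2 * s]
     lies in the disc of radius [3 * s], since [|w| <= |Re w| + |Im w|]. *)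
  have s32 : s < 3 / 2 * s by lra.
  apply: (holomorphic_primitive s32) => w wr wi; apply: df.
  by apply: le_lt_trans (normc_le_ReIm _) _; move: wr wi; clear; lra.
(* Normalized at 0, the primitive vanishes near 0 because its derivative does. *)
pose P (w : CC R) : CC R := P0 w - P0 0.
have dP w : normc w < s -> is_derive w (1 : CC R) P (f w).
  move=> ws; have dPw : is_derive w (1 : CC R) P0 (f w).
    by apply: dP0; [apply: le_lt_trans (Re_le_normc w) ws|apply: le_lt_trans (Im_le_normc w)
        ws].
  by apply: is_derive_eq; rewrite subr0.
pose e1 := Num.min e0 s.
have e10 : 0 < e1 by rewrite lt_min e00.
have Pnear w : normc w < e1 -> P w = 0.
  rewrite lt_min => /andP[we ws]; apply/Normc.eq0_normc/eqP; rewrite eq_le normc_ge0 andbT.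
  have := @mean_value_bound R P f 0 w 0; rewrite mulr0 mul0r add0r /P subrr subr0; apply.
    by move=> z; rewrite subr0 => zw; apply/dP/(le_lt_trans zw).
  by move=> z; rewrite subr0 => zw; rewrite f0 ?Normc.normc0 // (le_lt_trans zw).
suff Pz w : normc w < s -> P w = 0.
  move=> w ws; have ws' : 0 < s - normc w by rewrite subr_gt0.
  apply: (derive_near0 ws' (dP w ws)) => z zw; apply: Pz.
  by have := normcD (z - w) w; rewrite subrK; lra.
move=> w1s; apply/eqP; apply: contraT => Pw.
have [r wr rs] : exists2 r : R, normc w < r & r < s.
  by exists ((normc w + s) / 2); lra.
have w0 : 0 < normc w.
  rewrite normc_gt0; apply: contra Pw => /eqP ->; apply/eqP/Pnear; by rewrite Normc.normc0.
have r0 : 0 < r by exact: lt_trans wr.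
have Pc (z : CC R) : normc z <= r -> {for z, continuous P}.
  by move=> zr; apply: is_derive_cts (dP z _); apply: le_lt_trans rs.
have [a0 _ Mmax] := @max_on_disc (fun z => normc (P z)) r (ltW r0) (fun z zr =>
    continuous_comp (Pc z zr) (@normc_continuous _)).
pose M : R := normc (P a0); have M0 : 0 <= M := normc_ge0 _.
have Pw0 : 0 < normc (P w) by rewrite normc_gt0.
(* As [|w| < r], a large [n] makes [|P w| / |w|^n] exceed [M / r^n], the bound for [P z / z^n] on
   the circle of radius [r]. *)
have [n nP] : exists n, (normc w / r) ^+ n < normc (P w) / (M + 1).
  apply: expr_small; last by rewrite divr_gt0 // ltr_wpDl.
  by rewrite divr_ge0 ?normc_ge0 ?(ltW r0) //= ltr_pdivrMr // mul1r.
pose H (z : CC R) : CC R := P z * (z^-1) ^+ n.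
pose h (z : CC R) : CC R := f z * (z^-1) ^+ n - P z * (z^-1) ^+ n.+1 *+ n.
have nH z : normc (H z) = normc (P z) / normc z ^+ n.
  by rewrite /H Normc.normcM normcX Normc.normcV exprVn.
have wM : M / r ^+ n < normc (H w).
  rewrite nH ltr_pdivlMr ?exprn_gt0 // mulrAC -mulrA -exprVn -exprMn mulrC.
  apply: (@le_lt_trans _ _ ((normc w / r) ^+ n * (M + 1))).
    by rewrite ler_wpM2l ?lerDl // exprn_ge0 // divr_ge0 ?normc_ge0 // ltW.
  by rewrite -ltr_pdivlMr ?ltr_wpDl.
(* On the disc the term [e * |z|^2] is at most half the gap between [|H w|] and [M / r^n]. A maximum
   point [a] of the perturbed function therefore still has [|H a| > M / r^n], which keeps it off the
   circle. *)
pose e : R := (normc (H w) - M / r ^+ n) / (2 * r ^+ 2).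
have r2 : 0 < r ^+ 2 by rewrite exprn_gt0.
have e_gt0 : 0 < e by rewrite divr_gt0 ?mulr_gt0 // subr_gt0.
have er : e * r ^+ 2 = (normc (H w) - M / r ^+ n) / 2.
  by rewrite /e; field; rewrite expf_neq0 gt_eqF.
have dH (z : CC R) : z != 0 -> normc z < s -> is_derive z (1 : CC R) H (h z).
  by move=> z0 zs; apply: is_derive_divX => //; exact: dP.
(* Since [P] vanishes near 0, dividing by [z^n] creates no singularity, and the maximum point stays
   away from 0. *)
have H0 (z : CC R) : normc z < e1 -> H z = 0 by move=> ze; rewrite /H Pnear // mul0r.
have Hc (z : CC R) : normc z <= r -> {for z, continuous H}.
  move=> zr; have [->|z0] := eqVneq z 0; last first.
    by apply: is_derive_cts (dH z z0 _); apply: le_lt_trans rs.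
  apply/cts_normcP => x x0; exists e1 => // y; rewrite subr0 => ye.
  by rewrite !H0 ?subrr ?Normc.normc0.
pose v (z : CC R) := normc (H z) + e * normc z ^+ 2.
have vc (z : CC R) : normc z <= r -> {for z, continuous v}.
  move=> zr.
  have c1 : {for z, continuous (fun y : CC R => normc (H y))}.
    exact: continuous_comp (Hc z zr) (@normc_continuous _).
  have c2 : {for z, continuous (fun y : CC R => normc y)} := @normc_continuous z.
  exact: cvgD c1 (cvgM (cvg_cst _) (cvgM c2 c2)).
have [a ar amax] := max_on_disc (ltW r0) vc.
have wa : normc (H w) <= v a.
  apply: le_trans (amax w (ltW wr)); by rewrite /v lerDl mulr_ge0 ?exprn_ge0 ?normc_ge0 // ltW.
have ar2 : e * normc a ^+ 2 <= e * r ^+ 2.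
  by rewrite ler_pM2l // lerXn2r // nnegrE ?normc_ge0 // ltW.
have Mr : 0 <= M / r ^+ n by rewrite divr_ge0 // exprn_ge0 // ltW.
have v_lt : v a <= normc (H a) + (normc (H w) - M / r ^+ n) / 2 by rewrite /v lerD2l -er.
have Ha_gt : M / r ^+ n < normc (H a).
  by apply: (lt_of_le_half wM); exact: le_trans wa v_lt.
have Ha0 : H a != 0 by rewrite -normc_gt0; apply: le_lt_trans Ha_gt.
have ae : e1 <= normc a.
  by rewrite leNgt; apply: contra Ha0 => /H0 ->.
have ar1 : normc a < r.
  rewrite lt_neqAle ar andbT; apply: contraTneq Ha_gt => arE.
  by rewrite -leNgt nH arE ler_pM2r ?invr_gt0 ?exprn_gt0 // Mmax.
have a0' : a != 0 by rewrite -normc_gt0; apply: lt_le_trans ae.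
pose q := Num.min e1 (s - r).
have q0 : 0 < q by rewrite lt_min e10 subr_gt0.
have q1 : q <= e1 by rewrite ge_min lexx.
have q2 : q <= s - r by rewrite ge_min lexx orbT.
have dHa (z : CC R) : normc (z - a) < q -> is_derive z (1 : CC R) H (h z).
  move=> za; apply: dH.
    by apply: contraTneq za => ->; rewrite sub0r normcN -leNgt (le_trans q1).
  rewrite -[z](subrK a); apply: le_lt_trans (normcD _ _) _.
  by apply: lt_le_trans (ltrD za ar1) _; rewrite -lerBrDr.
have aS : normc a < s by apply: lt_trans rs.
have dh : derivable h a 1.
  have /derivableP dfa : derivable f a 1 by apply: df; apply: lt_trans aS _; rewrite ltr_pMl
      // ltr1n.
  have [d1 _] := is_derive_divX n (f := fun=> _) a0' dfa.
  have [d2 _] := is_derive_divX n.+1 a0' (dP a aS).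
  have -> : h = (fun z => f z * z^-1 ^+ n) - ((n%:R : CC R) \*: (fun z => P z * z^-1 ^+ n.+1)).
    by apply/funext => z; rewrite /h -[in LHS]mulr_natl.
  have d3 := @derivableZ _ _ _ _ (n%:R : CC R) _ _ d2.
  exact: derivableB d1 d3.
move/derivableP : dh => dh.
by have := no_interior_max e_gt0 q0 dHa dh Ha0 ar1; case.
Qed.

End MaximumPrinciple.

(** * Power series *)

Section PowerSeries.
Context {R : realType}.
Implicit Types (y z : CC R) (b : nat -> CC R) (K r : R) (u v : nat -> CC R).

Lemma normc_sum (I : Type) (s : seq I) (P : pred I) (F : I -> CC R) :
  normc (\sum_(i <- s | P i) F i) <= \sum_(i <- s | P i) normc (F i).
Proof.
elim/big_ind2: _ => [|x x' z z' H H'|//]; first by rewrite Normc.normc0.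
by apply: le_trans (normcD _ _) _; exact: lerD.
Qed.

Lemma geometric_sum_le r n : 0 <= r < 1 -> \sum_(0 <= i < n) r ^+ i <= (1 - r)^-1.
Proof.
move=> /andP[r0 r1]; have r1' : 0 < 1 - r by rewrite subr_gt0.
rewrite -[leRHS]mul1r ler_pdivlMr // mulrC big_mkord.
have -> : (1 - r) * \sum_(i < n) r ^+ i = 1 - r ^+ n.
  by have := subrX1 r n => E; rewrite -opprB mulNr -E opprB.
by rewrite lerBlDr lerDl exprn_ge0.
Qed.

Lemma cvg_ReIm u (x y : R) :
  (fun n => Re (u n)) @ \oo --> x -> (fun n => Im (u n)) @ \oo --> y ->
  u @ \oo --> (Complex x y : CC R).
Proof.
move=> /cvgrPdist_lt ux /cvgrPdist_lt uy; apply/cvg_normcP => e e0.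
have e20 : 0 < e / 2 by rewrite divr_gt0.
have {}ux := ux _ e20; have {}uy := uy _ e20.
near=> n; apply: le_lt_trans (normc_le_ReIm _) _.
have -> : e = e / 2 + e / 2 by field.
apply: ltrD; rewrite ?ReD ?ReN ?ImD ?ImN distrC /=; near: n.
  exact: ux.
exact: uy.
Unshelve. all: by end_near. Qed.

Lemma normc_lim_le u (l : CC R) K : u @ \oo --> l -> (forall n, normc (u n) <= K) ->
  normc l <= K.
Proof.
move=> /cvg_normcP ul uK; apply/ler_addgt0Pr => e e0.
have [N _ /(_ N (leqnn N)) NP] := ul e e0.
have -> : l = u N - (u N - l) by rewrite opprB addrC subrK.
apply: le_trans (normcD _ _) _; rewrite normcN; apply: lerD => //; exact: ltW.
Qed.

Lemma CC_cvg_unique u (l l' : CC R) : u @ \oo --> l -> u @ \oo --> l' -> l = l'.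
Proof. by apply: cvg_unique; exact: norm_hausdorff. Qed.

Lemma series_geometric_cvg (u : nat -> R) K r : 0 <= r < 1 ->
  (forall n, `|u n| <= K * r ^+ n) -> cvg (series u @ \oo).
Proof.
move=> /andP[r0 r1] uK; apply: normed_cvg.
have v0 n : 0 <= geometric K r n := le_trans (normr_ge0 _) (uK n).
have r1' : `|r| < 1 by rewrite ger0_norm.
exact: (series_le_cvg (fun n => normr_ge0 (u n)) v0 uK (is_cvg_geometric_series r1')).
Qed.

Definition psum b y : CC R := lim (series (fun n => b n * y ^+ n : CC R) @ \oo).

Lemma psum_cvg b K y : (forall n, normc (b n) <= K) -> normc y < 1 ->
  series (fun n => b n * y ^+ n : CC R) @ \oo --> psum b y.
Proof.
move=> bK y1.
have bd n : normc (b n * y ^+ n) <= K * normc y ^+ n.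
  by rewrite Normc.normcM normcX ler_wpM2r // exprn_ge0 // normc_ge0.
have y01 : 0 <= normc y < 1 by rewrite normc_ge0.
have /cvg_ex[x1 c1] : cvg (series (fun n => Re (b n * y ^+ n)) @ \oo).
  apply: (series_geometric_cvg y01) => n; apply: le_trans (bd n); exact: Re_le_normc.
have /cvg_ex[x2 c2] : cvg (series (fun n => Im (b n * y ^+ n)) @ \oo).
  apply: (series_geometric_cvg y01) => n; apply: le_trans (bd n); exact: Im_le_normc.
suff H : series (fun n => b n * y ^+ n : CC R) @ \oo --> (Complex x1 x2 : CC R).
  by apply/cvg_ex; exists (Complex x1 x2 : CC R).
apply: cvg_ReIm.
  suff -> : (fun n => Re (series (fun n => b n * y ^+ n : CC R) n)) = series (fun n => Re (b
      n * y ^+ n)) by [].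
  apply/funext => n; rewrite /series /=; elim/big_ind2: _ => // a a' c c' <- <-; exact: ReD.
suff -> : (fun n => Im (series (fun n => b n * y ^+ n : CC R) n)) = series (fun n => Im (b n
    * y ^+ n)) by [].
by apply/funext => n; rewrite /series /=; elim/big_ind2: _ => // a a' c c' <- <-; exact: ImD.
Qed.

Lemma psum_unique b K y l : (forall n, normc (b n) <= K) -> normc y < 1 ->
  series (fun n => b n * y ^+ n : CC R) @ \oo --> l -> psum b y = l.
Proof. by move=> bK y1; apply: CC_cvg_unique (psum_cvg bK y1). Qed.

Lemma psum_le b K y : (forall n, normc (b n) <= K) -> normc y < 1 ->
  normc (psum b y) <= K / (1 - normc y).
Proof.
move=> bK y1; have K0 : 0 <= K by apply: le_trans (bK 0%N); exact: normc_ge0.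
apply: normc_lim_le (psum_cvg bK y1) _ => n.
apply: le_trans (normc_sum _ _ _) _.
apply: (@le_trans _ _ (\sum_(0 <= i < n) K * normc y ^+ i)).
  by apply: ler_sum => i _; rewrite Normc.normcM normcX ler_wpM2r // exprn_ge0 // normc_ge0.
by rewrite -mulr_sumr ler_wpM2l // geometric_sum_le // normc_ge0.
Qed.

Lemma psum_shift b K y : (forall n, normc (b n) <= K) -> normc y < 1 ->
  psum b y = b 0%N + y * psum (fun n => b n.+1) y.
Proof.
move=> bK y1; apply: (psum_unique bK y1).
have c1 := psum_cvg (b := fun n => b n.+1) (fun n => bK n.+1) y1.
have c2 : (fun n => b 0%N + y * series (fun n => b n.+1 * y ^+ n : CC R) n) @ \oo -->
  b 0%N + y * psum (fun n => b n.+1) y.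
  exact: (cvgD (cvg_cst _) (cvgM (cvg_cst _) c1)).
rewrite -(cvg_shiftS (series _)).
set v := (v in v @ _ --> _); suff -> : v = (fun n => b 0%N + y * series (fun n => b n.+1 * y
    ^+ n : CC R) n) by [].
apply/funext => n; rewrite /v.
rewrite /series /= big_nat_recl // expr0 mulr1 mulr_sumr; congr (_ + _).
by apply: eq_bigr => i _; rewrite exprS; ring.
Qed.

Lemma psum_partial b K y N : (forall n, normc (b n) <= K) -> normc y < 1 ->
  psum b y = \sum_(0 <= i < N) b i * y ^+ i + y ^+ N * psum (fun n => b (N + n)%N) y.
Proof.
move=> bK y1; elim: N => [|N IH].
  by rewrite big_geq // add0r expr0 mul1r; congr psum; apply/funext => n.
rewrite IH big_nat_recr //= -addrA; congr (_ + _).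
rewrite (psum_shift (K := K)) // addn0 exprSr -mulrA -[_ * (y * _)]mulrCA.
rewrite mulrDr [_ * b N]mulrC mulrCA; congr (_ + _ * (_ * _)).
by congr psum; apply/funext => n; rewrite addSnnS.
Qed.

(* Coefficients of the quotient of [psum b y - psum b y0] by [y - y0]. *)
Definition psum_quotient b y0 : nat -> CC R := fun i => psum (fun n => b (i.+1 + n)%N) y0.

Lemma psum_quotient_le b K y0 n : (forall n, normc (b n) <= K) -> normc y0 < 1 ->
  normc (psum_quotient b y0 n) <= K / (1 - normc y0).
Proof. by move=> bK y1; apply: psum_le. Qed.

Lemma cvg_expC0 K y u : normc y < 1 -> (forall n, normc (u n) <= K) ->
  (fun n => u n * y ^+ n) @ \oo --> (0 : CC R).
Proof.
move=> y1 uK; apply/cvg_normcP => e e0.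
have K0 : 0 <= K by apply: le_trans (uK 0%N); exact: normc_ge0.
have /cvgr0Pnorm_lt /(_ e e0) : (geometric K (normc y)) @ \oo --> (0 : R).
  by apply: cvg_geometric; rewrite ger0_norm // normc_ge0.
apply: filterS => n; rewrite subr0 Normc.normcM normcX /geometric /= => H.
apply: le_lt_trans H; rewrite ger0_norm ?mulr_ge0 ?exprn_ge0 ?normc_ge0 //.
by rewrite ler_wpM2r // exprn_ge0 // normc_ge0.
Qed.

(** Synthetic division: [g n = b n.+1 + y0 * g n.+1] makes the partial sums telescope, up to the
    remainder [y0 * g n * y^n], which tends to 0. *)
Lemma psum_diff b K y y0 : (forall n, normc (b n) <= K) -> normc y < 1 -> normc y0 < 1 ->
  psum b y = psum b y0 + (y - y0) * psum (psum_quotient b y0) y.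
Proof.
move=> bK y1 y01; apply: (psum_unique bK y1).
set g := psum_quotient b y0; set K' := K / (1 - normc y0).
have gK n : normc (g n) <= K' by exact: psum_quotient_le.
have g0 : psum b y0 = b 0%N + y0 * g 0%N by rewrite (psum_shift bK).
have gS n : g n = b n.+1 + y0 * g n.+1.
  rewrite /g /psum_quotient (psum_shift (K := K)) // addn0; congr (_ + _ * _).
  by congr psum; apply/funext => m; rewrite addnS.
have E n : series (fun n => b n * y ^+ n : CC R) n.+1 =
    psum b y0 + (y - y0) * series (fun n => g n * y ^+ n : CC R) n - y0 * (g n * y ^+ n).
  elim: n => [|n IH].
    by rewrite /series /= big_nat1 big_geq // expr0 g0; ring.
  have S u m : series u m.+1 = series u m + u m :> CC R by rewrite /series /= big_nat_recr.
  by rewrite S IH [in RHS]S [X in (y - y0) * (_ + X * _)]gS [in LHS]gS exprS; ring.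
rewrite -(cvg_shiftS (series _)).
have -> : [sequence series (fun n => b n * y ^+ n : CC R) n.+1]_n =
  (fun n => psum b y0 + (y - y0) * series (fun n => g n * y ^+ n : CC R) n - y0 * (g n * y ^+
      n)).
  by apply/funext => n; rewrite /= E.
have lim0 := cvgB (cvgD (cvg_cst (psum b y0)) (cvgM (cvg_cst (y - y0)) (psum_cvg gK y1)))
  (cvgM (cvg_cst y0) (cvg_expC0 y1 gK)).
by rewrite mulr0 subr0 in lim0; exact: lim0.
Qed.

Lemma psum_lipschitz b K y y0 r : (forall n, normc (b n) <= K) ->
  normc y <= r -> normc y0 <= r -> r < 1 ->
  normc (psum b y - psum b y0) <= K / (1 - r) ^+ 2 * normc (y - y0).
Proof.
move=> bK yr y0r r1.
have y1 := le_lt_trans yr r1; have y01 := le_lt_trans y0r r1.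
have K0 : 0 <= K by apply: le_trans (bK 0%N); exact: normc_ge0.
rewrite (psum_diff bK y1 y01) addrAC subrr add0r Normc.normcM mulrC.
rewrite ler_wpM2r ?normc_ge0 //.
apply: le_trans (psum_le (fun n => psum_quotient_le n bK y01) y1) _.
rewrite expr2 invfM mulrA; apply: ler_pM.
- by rewrite divr_ge0 // subr_ge0 ltW.
- by rewrite invr_ge0 subr_ge0 ltW.
- by rewrite ler_wpM2l // lef_pV2 ?posrE ?subr_gt0 // lerB.
- by rewrite lef_pV2 ?posrE ?subr_gt0 // lerB.
Qed.

(** The difference quotient at [y] is itself a bounded-coefficient power series; the derivative is
    its value at [y], and its Lipschitz bound makes the error quadratic in [h]. *)
Lemma psum_derivable b K y : (forall n, normc (b n) <= K) -> normc y < 1 ->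
  derivable (psum b) y 1.
Proof.
move=> bK y1; suff : is_derive y (1 : CC R) (psum b) (psum (psum_quotient b y) y) by case.
set g := psum_quotient b y; set K' := K / (1 - normc y).
have gK n : normc (g n) <= K' by exact: psum_quotient_le.
have K'0 : 0 <= K' by apply: le_trans (gK 0%N); exact: normc_ge0.
pose r := (1 + normc y) / 2; have r1 : r < 1 by rewrite /r; lra.
have yr : normc y < r by rewrite /r; lra.
pose L := K' / (1 - r) ^+ 2.
have L0 : 0 <= L by rewrite divr_ge0 // exprn_ge0 // subr_ge0 ltW.
apply/is_deriveCP => e e0; exists (Num.min (r - normc y) (e / (L + 1))).
  by rewrite lt_min subr_gt0 yr divr_gt0 // ltr_wpDl.
move=> h; rewrite lt_min => /andP[hr he].
have yhr : normc (y + h) <= r by apply: le_trans (normcD _ _) _; move: hr; clear; lra.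
rewrite (psum_diff (y := y + h) bK (le_lt_trans yhr r1) y1).
have aux (p q q' : CC R) : p + (y + h - y) * q - p - q' * h = (q - q') * h by ring.
rewrite aux Normc.normcM ler_wpM2r ?normc_ge0 //.
apply: le_trans (psum_lipschitz gK yhr (ltW yr) r1) _.
rewrite [y + h]addrC addrK -/L; apply: (@le_trans _ _ ((L + 1) * normc h)).
  by rewrite ler_wpM2r ?normc_ge0 // lerDl.
by rewrite mulrC -ler_pdivlMr ?ltr_wpDl // ltW.
Qed.

(** Truncation order and argument move together, as in the polynomial approximants used later; the
    tails are uniformly at most [K / (1 - r) * r^n]. *)
Lemma psum_diagonal b K u y r : (forall n, normc (b n) <= K) -> r < 1 ->
  u @ \oo --> y -> (forall n, normc (u n) <= r) ->
  (fun n => \sum_(0 <= i < n) b i * u n ^+ i) @ \oo --> psum b y.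
Proof.
move=> bK r1 uy ur; have yr := normc_lim_le uy ur.
have r0 : 0 <= r by apply: le_trans yr; exact: normc_ge0.
have K0 : 0 <= K by apply: le_trans (bK 0%N); exact: normc_ge0.
have pc : (fun n => psum b (u n)) @ \oo --> psum b y.
  have /derivableP/is_derive_cts pcy := psum_derivable bK (le_lt_trans yr r1).
  exact: continuous_cvg pcy uy.
have tl : (fun n => psum b (u n) - \sum_(0 <= i < n) b i * u n ^+ i) @ \oo --> (0 : CC R).
  apply/cvg_normcP => e e0.
  have /cvgr0Pnorm_lt /(_ e e0) : (geometric (K / (1 - r)) r) @ \oo --> (0 : R).
    by apply: cvg_geometric; rewrite ger0_norm.
  apply: filterS => n; rewrite subr0 /geometric /= => H.
  apply: le_lt_trans H; have un1 := le_lt_trans (ur n) r1.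
  rewrite (psum_partial n bK un1) addrAC subrr add0r Normc.normcM normcX.
  have r10 : 0 < 1 - r by rewrite subr_gt0.
  rewrite ger0_norm; last by rewrite mulr_ge0 ?exprn_ge0 // divr_ge0 // ltW.
  rewrite mulrC; apply: ler_pM; rewrite ?normc_ge0 ?exprn_ge0 ?normc_ge0 //.
    apply: le_trans (psum_le _ un1) _ => //.
    by rewrite ler_wpM2l // lef_pV2 ?posrE ?subr_gt0 // lerB.
  by rewrite lerXn2r // nnegrE // normc_ge0.
set v := (v in v @ _ --> _).
suff -> : v = (fun n => psum b (u n) - (psum b (u n) - v n)) by rewrite -[psum b y]subr0;
    exact: cvgB pc tl.
by apply/funext => n; rewrite subKr.
Qed.

End PowerSeries.

(** * Formal power series and polynomial norms *)

Section EqModXn.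
Context {A : comNzRingType}.
Implicit Types (p q : {poly A}).

Definition eq_modXn (N : nat) p q : Prop := forall k, (k < N)%N -> p`_k = q`_k.

Lemma eq_modXnM N p p' q q' : eq_modXn N p p' -> eq_modXn N q q' ->
  eq_modXn N (p * q) (p' * q').
Proof.
move=> pp qq k kN; rewrite !coefM; apply: eq_bigr => i _.
by rewrite pp ?qq // (leq_ltn_trans _ kN) // ?leq_subr // -ltnS.
Qed.

Lemma eq_modXnX N p p' n : eq_modXn N p p' -> eq_modXn N (p ^+ n) (p' ^+ n).
Proof.
by move=> pp; elim: n => [|n IH]; rewrite ?expr0 ?exprS //; exact: eq_modXnM.
Qed.

Lemma coef_exp0 p n k : p`_0 = 0 -> (k < n)%N -> (p ^+ n)`_k = 0.
Proof.
move=> p0; elim: n k => // n IH k kn; rewrite exprS coefM big1 // => i _.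
have [->|i0] := posnP i; first by rewrite p0 mul0r.
by rewrite IH ?mulr0 // -ltnS (leq_trans _ kn) // ltnS ltn_subrL i0 /= (leq_trans i0) // -ltnS.
Qed.

Lemma coef0_exp p n : (p ^+ n)`_0 = p`_0 ^+ n.
Proof. by rewrite -!horner_coef0 horner_exp. Qed.

(** As [q] has no constant term, the powers [q^i] with [i > k] do not reach degree [k]. This reduces
    formal composition to that of polynomials. *)
Lemma coef_comp_poly_fps (g h : nat -> A) p q N k : q`_0 = 0 -> (k < N)%N ->
  (forall i, (i < N)%N -> p`_i = g i) -> (forall i, (i < N)%N -> q`_i = h i) ->
  (p \Po q)`_k = fps_comp g h k.
Proof.
move=> q0 kN pg qh; rewrite /fps_comp comp_polyE.
pose F i := p`_i *: q ^+ i.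
have E : (\sum_(i < size p) F i)`_k = (\sum_(i < k.+1) F i)`_k.
  pose m := maxn (size p) k.+1.
  have -> : \sum_(i < size p) F i = \sum_(i < m) F i.
    rewrite (big_ord_widen m F) ?leq_maxl // big_mkcond; apply: eq_bigr => i _.
    by case: ltnP => // ip; rewrite /F nth_default // scale0r.
  rewrite !coef_sum (@big_ord_widen _ _ _ k.+1 m (fun i => (F i)`_k)) ?leq_maxr // [in
      RHS]big_mkcond.
  apply: eq_bigr => i _; case: ltnP => // ki; rewrite /F coefZ coef_exp0 ?mulr0 //.
rewrite E !coef_sum; apply: eq_bigr => -[i ik] _ /=.
rewrite /F !coefZ pg; last by apply: leq_trans kN.
congr (_ * _); apply: (@eq_modXnX k.+1) => // j jk.
by rewrite coef_poly jk qh // (leq_trans jk).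
Qed.

Lemma fps_comp0 (g h : nat -> A) : fps_comp g h 0 = g 0%N.
Proof. by rewrite /fps_comp big_ord1 expr0 coefZ coef1 mulr1. Qed.

Lemma fps_compA (f g h : nat -> A) : g 0%N = 0 -> h 0%N = 0 ->
  fps_comp (fps_comp f g) h = fps_comp f (fps_comp g h).
Proof.
move=> g0 h0; apply/funext => n; pose T (f : nat -> A) := \poly_(i < n.+1) f i.
have TE f' i : (i < n.+1)%N -> (T f')`_i = f' i by move=> iN; rewrite coef_poly iN.
have T0 f' : f' 0%N = 0 -> (T f')`_0 = 0 by move=> ?; rewrite TE.
have fg i : (i < n.+1)%N -> (T f \Po T g)`_i = fps_comp f g i.
  by move=> iN; apply: (coef_comp_poly_fps (N := n.+1)) => //; [exact: T0|exact: TE|exact: TE].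
have gh i : (i < n.+1)%N -> (T g \Po T h)`_i = fps_comp g h i.
  by move=> iN; apply: (coef_comp_poly_fps (N := n.+1)) => //; [exact: T0|exact: TE|exact: TE].
rewrite -(@coef_comp_poly_fps _ _ (T f \Po T g) (T h) n.+1) //; [|exact: T0|exact: TE].
rewrite -(@coef_comp_poly_fps _ _ (T f) (T g \Po T h) n.+1) //; [|by rewrite gh //
    fps_comp0|exact: TE].
by rewrite comp_polyA.
Qed.

End EqModXn.

Lemma fps_comp_morph (A B : comNzRingType) (u : {rmorphism A -> B}) (g h : nat -> A) n :
  u (fps_comp g h n) = fps_comp (u \o g) (u \o h) n.
Proof.
rewrite /fps_comp !coef_sum rmorph_sum; apply: eq_bigr => i _ /=.
rewrite !coefZ rmorphM -coef_map rmorphXn /=.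
suff -> : map_poly u (\poly_(i < n.+1) h i) = \poly_(i < n.+1) u (h i) by [].
by apply/polyP => j; rewrite coef_map !coef_poly; case: ifP => _; rewrite ?raddf0.
Qed.

(** * Coefficientwise majorants of polynomials *)

Section PolyNorm.
Context {R : realType}.
Implicit Types (p q : {poly R[i]}) (t : R) (z : CC R).

(** The weighted l^1 norm: submultiplicative, compatible with composition, and a bound for the
    values on the disc of radius [t]. *)
Definition pnorm p t : R := (map_poly (@Normc.normc R) p).[t].

Lemma coef_map_normc p i : (map_poly (@Normc.normc R) p)`_i = normc p`_i.
Proof. by rewrite coef_map_id0 // Normc.normc0. Qed.

Lemma horner_le (p q : {poly R}) t : 0 <= t -> (forall i, p`_i <= q`_i) ->
  p.[t] <= q.[t].
Proof.
move=> t0 pq; rewrite (horner_coef_wide t (leq_maxl _ (size q))).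
rewrite (horner_coef_wide t (leq_maxr (size p) _)).
by apply: ler_sum => i _; rewrite ler_wpM2r // exprn_ge0.
Qed.

Lemma pnorm_le p t t' : 0 <= t <= t' -> pnorm p t <= pnorm p t'.
Proof.
move=> /andP[t0 tt]; rewrite /pnorm !horner_coef; apply: ler_sum => i _.
by rewrite coef_map_normc ler_wpM2l ?normc_ge0 // lerXn2r // nnegrE (le_trans t0).
Qed.

Lemma pnorm_ge0 p t : 0 <= t -> 0 <= pnorm p t.
Proof.
move=> t0; rewrite /pnorm horner_coef sumr_ge0 // => i _.
by rewrite coef_map_normc mulr_ge0 ?normc_ge0 ?exprn_ge0.
Qed.

Lemma pnormM p q t : 0 <= t -> pnorm (p * q) t <= pnorm p t * pnorm q t.
Proof.
move=> t0; rewrite /pnorm -hornerM; apply: horner_le => // i.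
rewrite coef_map_normc !coefM; apply: le_trans (normc_sum _ _ _) _.
by apply: ler_sum => j _; rewrite !coef_map_normc Normc.normcM.
Qed.

Lemma pnormD p q t : 0 <= t -> pnorm (p + q) t <= pnorm p t + pnorm q t.
Proof.
move=> t0; rewrite /pnorm -hornerD; apply: horner_le => // i.
by rewrite coefD !coef_map_normc coefD normcD.
Qed.

Lemma pnormC (c : R[i]) t : pnorm c%:P t = normc c.
Proof.
rewrite /pnorm; have -> : map_poly (@Normc.normc R) c%:P = (normc c)%:P.
  by apply/polyP => i; rewrite coef_map_normc !coefC; case: eqP => // _; rewrite Normc.normc0.
by rewrite hornerC.
Qed.

Lemma pnorm_Xn n t : pnorm 'X^n t = t ^+ n.
Proof.
rewrite /pnorm; have -> : map_poly (@Normc.normc R) 'X^n = 'X^n :> {poly R}.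
  by apply/polyP => i; rewrite coef_map_normc !coefXn; case: eqP => // _; rewrite
      ?Normc.normc0 ?Normc.normc1.
by rewrite hornerXn.
Qed.

Lemma pnorm_sum (I : Type) (s : seq I) (P : pred I) (F : I -> {poly R[i]}) t : 0 <= t ->
  pnorm (\sum_(i <- s | P i) F i) t <= \sum_(i <- s | P i) pnorm (F i) t.
Proof.
move=> t0; elim/big_ind2: _ => [|x x' z z' H H'|//].
  by rewrite -polyC0 pnormC Normc.normc0.
by apply: le_trans (pnormD _ _ t0) _; exact: lerD.
Qed.

Lemma pnormX p n t : 0 <= t -> pnorm (p ^+ n) t <= pnorm p t ^+ n.
Proof.
move=> t0; elim: n => [|n IH]; first by rewrite !expr0 -polyC1 pnormC Normc.normc1.
rewrite !exprS; apply: le_trans (pnormM _ _ t0) _.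
by rewrite ler_wpM2l // pnorm_ge0.
Qed.

Lemma pnormZ (c : R[i]) p t : 0 <= t -> pnorm (c *: p) t <= normc c * pnorm p t.
Proof. by move=> t0; rewrite -mul_polyC -(pnormC c t); exact: pnormM. Qed.

Lemma pnorm_comp p q t : 0 <= t -> pnorm (p \Po q) t <= pnorm p (pnorm q t).
Proof.
move=> t0; rewrite comp_polyE; apply: le_trans (pnorm_sum _ _ _ t0) _.
rewrite {2}/pnorm (@horner_coef_wide _ (size p)); last exact: size_poly.
apply: ler_sum => i _; apply: le_trans (pnormZ _ _ t0) _.
by rewrite coef_map_normc ler_wpM2l ?normc_ge0 // pnormX.
Qed.

Lemma normc_horner_le p z : normc p.[z] <= pnorm p (normc z).
Proof.
rewrite horner_coef /pnorm (@horner_coef_wide _ (size p)); last exact: size_poly.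
apply: le_trans (normc_sum _ _ _) _; apply: ler_sum => i _.
by rewrite coef_map_normc Normc.normcM normcX.
Qed.

(** Doubling the radius multiplies the term of degree [i] by [2^i], which is at least [2^N] for
    every omitted term. *)
Lemma horner_truncation p N z :
  normc (\sum_(0 <= i < N) p`_i * z ^+ i - p.[z]) <= 2^-1 ^+ N * pnorm p (2 * normc z).
Proof.
pose m := maxn (size p) N; have z0 := normc_ge0 z.
have -> : p.[z] = \sum_(0 <= i < N) p`_i * z ^+ i + \sum_(N <= i < m) p`_i * z ^+ i.
  by rewrite -big_cat_nat ?leq_maxr //= big_mkord -horner_coef_wide // leq_maxl.
rewrite opprD addrA subrr sub0r normcN; apply: le_trans (normc_sum _ _ _) _.
have -> : pnorm p (2 * normc z) = \sum_(0 <= i < N) normc p`_i * (2 * normc z) ^+ i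
   + \sum_(N <= i < m) normc p`_i * (2 * normc z) ^+ i.
  rewrite -big_cat_nat ?leq_maxr //= big_mkord /pnorm (@horner_coef_wide _ m).
    by apply: eq_bigr => i _; rewrite coef_map_normc.
  by apply: leq_trans (size_poly _ _) _; exact: leq_maxl.
rewrite mulrDr; apply: (@le_trans _ _ (2^-1 ^+ N * \sum_(N <= i < m) normc p`_i * (2 * normc
    z) ^+ i)); last first.
  rewrite lerDr mulr_ge0 ?exprn_ge0 ?invr_ge0 // sumr_ge0 // => i _.
  by rewrite mulr_ge0 ?normc_ge0 // exprn_ge0 // mulr_ge0.
rewrite mulr_sumr; apply: ler_sum_nat => i /andP[Ni _].
rewrite Normc.normcM normcX mulrCA ler_wpM2l ?normc_ge0 // exprMn mulrA ler_peMl ?exprn_ge0 //.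
by rewrite -(subnK Ni) exprD mulrCA -exprMn mulVf // expr1n mulr1 exprn_ege1 // ler1n.
Qed.

(** The bridge between formal coefficients and values: the [N]-th partial sum is the truncation of
    [A N], hence within [K / 2^N] of [(A N).[z]]. *)
Lemma series_of_truncations (a : nat -> R[i]) (A : nat -> {poly R[i]}) z (K : R) (l : CC R) :
  (forall N k, (k < N)%N -> (A N)`_k = a k) ->
  (forall N, pnorm (A N) (2 * normc z) <= K) ->
  (fun N => (A N).[z] : CC R) @ \oo --> l ->
  series (fun n => a n * z ^+ n : CC R) @ \oo --> l.
Proof.
move=> Aa AK Al.
have K0 : 0 <= K by apply: le_trans (AK 0%N); rewrite pnorm_ge0 // mulr_ge0 ?normc_ge0.
have tl : (fun N => series (fun n => a n * z ^+ n : CC R) N - (A N).[z]) @ \oo --> (0 : CC R).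
  apply/cvg_normcP => e e0.
  have /cvgr0Pnorm_lt /(_ e e0) : (geometric K 2^-1) @ \oo --> (0 : R).
    by apply: cvg_geometric; rewrite ger0_norm // invf_lt1 // ltr1n.
  apply: filterS => n; rewrite subr0 /geometric /= => H; apply: le_lt_trans H.
  rewrite ger0_norm ?mulr_ge0 ?exprn_ge0 //.
  have -> : series (fun n => a n * z ^+ n : CC R) n = \sum_(0 <= i < n) (A n)`_i * z ^+ i.
    by apply: eq_big_nat => i /andP[_ ni]; rewrite Aa.
  apply: le_trans (horner_truncation _ _ _) _.
  by rewrite mulrC ler_wpM2r // exprn_ge0 // invr_ge0.
set v := (v in v @ _ --> _).
suff -> : v = (fun N => (v N - (A N).[z]) + (A N).[z]) by rewrite -[l]add0r; exact: cvgD tl Al.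
by apply/funext => n; rewrite subrK.
Qed.

End PolyNorm.

(** * Integral combinations *)

Section Rounding.
Context {R : realType} (T : nat -> nat -> R).
Hypothesis T1 : forall k, T k k = 1.

(** The list of earlier choices makes the course-of-values recursion structural. [S] is what they
    contribute in degree [k]; [ceil S - S] lies in [[0, 1)], and the bit [s k] selects this value or
    its translate by 1. *)
Fixpoint rounding_seq (s : nat -> bool) (n : nat) : seq R :=
  if n is k.+1 then
    let l := rounding_seq s k in
    let S := \sum_(m < k) nth 0 l m * T k m in
    rcons l ((Num.ceil S)%:~R - S + (s k)%:R)
  else [::].

Definition rounding_coef s k := nth 0 (rounding_seq s k.+1) k.

Definition rounding_sum s k := \sum_(m < k) rounding_coef s m * T k m.

Definition rounded s k : int := Num.ceil (rounding_sum s k) + (s k)%:Z.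

Lemma size_rounding_seq s n : size (rounding_seq s n) = n.
Proof. by elim: n => //= n IH; rewrite size_rcons IH. Qed.

Lemma nth_rounding_seq s n m : (m < n)%N -> nth 0 (rounding_seq s n) m = rounding_coef s m.
Proof.
elim: n => // n IH; rewrite ltnS leq_eqVlt => /orP[/eqP -> //|mn].
by rewrite /= nth_rcons size_rounding_seq mn IH.
Qed.

Lemma rounding_coefE s k : rounding_coef s k =
  (Num.ceil (rounding_sum s k))%:~R - rounding_sum s k + (s k)%:R.
Proof.
rewrite {1}/rounding_coef /= nth_rcons size_rounding_seq ltnn eqxx.
suff -> : \sum_(m < k) nth 0 (rounding_seq s k) m * T k m = rounding_sum s k by [].
by apply: eq_bigr => i _; rewrite nth_rounding_seq.
Qed.

Lemma rounding_coef_bound s k : `|rounding_coef s k| <= 2.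
Proof.
rewrite rounding_coefE; have := ceil_itv (rounding_sum s k).
rewrite intrD intrN /= => /andP[A B]; rewrite ler_norml.
by case: (s k) => /=; apply/andP; split; lra.
Qed.

Lemma roundedE s k : (rounded s k)%:~R = \sum_(m < k.+1) rounding_coef s m * T k m.
Proof.
rewrite big_ord_recr /= T1 mulr1 rounding_coefE -/(rounding_sum s k) /rounded.
by rewrite intrD addrCA addrA subrK.
Qed.

(** By strong induction equal earlier coefficients give equal sums, so the ceilings cancel and leave
    the bits. *)
Lemma rounded_inj : injective rounded.
Proof.
move=> s s' ss; apply/funext => k.
suff [] : s k = s' k /\ rounding_coef s k = rounding_coef s' k by [].
elim/ltn_ind: k => k IH.
have S : rounding_sum s k = rounding_sum s' k.
  by apply: eq_bigr => i _; have [_ ->] := IH i (ltn_ord i).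
have E : s k = s' k.
  have /(congr1 (fun g => g k)) := ss; rewrite /rounded S => /addrI [].
  by case: (s k); case: (s' k).
by rewrite !rounding_coefE S E.
Qed.

End Rounding.

(** * Polynomial truncations of [X^(m mod d) h^(m div d)] *)

Section InverseTruncation.
Context {A : comNzRingType} (p : {poly A}).

(** Truncated geometric series for [1 / p], correct modulo [X^N] when [p] has constant term 1. *)
Definition inv_trunc N : {poly A} := \sum_(k < N) (1 - p) ^+ k.

(** With [h = X^d / p], the series [X^(m mod d) h^(m div d)] equals [X^m p^-(m div d)]; this form
    displays its leading term. *)
Definition twisted_monomial (d N m : nat) : {poly A} := 'X^m * inv_trunc N ^+ (m %/ d).

Hypothesis p1 : p`_0 = 1.

Lemma inv_trunc_mod N N' : (N <= N')%N -> eq_modXn N (inv_trunc N) (inv_trunc N').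
Proof.
move=> NN k kN; rewrite /inv_trunc (big_ord_widen N' (fun i => (1 - p) ^+ i)) // big_mkcond.
rewrite !coef_sum; apply: eq_bigr => i _; case: ltnP => // Ni.
by rewrite coef0 coef_exp0 ?(leq_trans kN) // coefB coef1 p1 subrr.
Qed.

Lemma twisted_monomial_mod d N N' m : (N <= N')%N ->
  eq_modXn N (twisted_monomial d N m) (twisted_monomial d N' m).
Proof. by move=> NN; apply/eq_modXnM/eq_modXnX/inv_trunc_mod. Qed.

Lemma twisted_monomial_small d N m k : (k < m)%N -> (twisted_monomial d N m)`_k = 0.
Proof. by move=> km; rewrite coefXnM km. Qed.

Lemma twisted_monomial_lead d N m : (0 < N)%N -> (twisted_monomial d N m)`_m = 1.
Proof.
case: N => // N _; rewrite coefXnM ltnn subnn coef0_exp /inv_trunc coef_sum big_ord_recl.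
rewrite expr0 coef1 big1 ?addr0 ?expr1n // => i _.
by rewrite coef_exp0 // coefB coef1 p1 subrr.
Qed.

End InverseTruncation.

(** * The analytic function attached to the rounded coefficients, and its germ *)

Section Germ.
Context {R : realType}.
Implicit Types (z w y : CC R).

Lemma pnorm_small (q : {poly R[i]}) (e : R) : q`_0 = 0 -> 0 < e ->
  exists2 s : R, 0 < s & forall t, 0 <= t <= s -> pnorm q t <= e.
Proof.
move=> q0 e0; have L0 : 0 <= pnorm q 1 by exact: pnorm_ge0.
exists (Num.min 1 (e / (pnorm q 1 + 1))) => [|t /andP[t0]].
  by rewrite lt_min ltr01 divr_gt0 // ltr_wpDl.
rewrite le_min => /andP[t1 te].
apply: (@le_trans _ _ (t * (pnorm q 1 + 1))); last by rewrite -ler_pdivlMr // ltr_wpDl.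
apply: (@le_trans _ _ (t * pnorm q 1)); last by rewrite ler_wpM2l // lerDl.
rewrite /pnorm !horner_coef mulr_sumr; apply: ler_sum => i _.
rewrite coef_map_normc expr1n mulr1 mulrC.
case: (nat_of_ord i) => [|n]; first by rewrite q0 Normc.normc0 !mulr0.
apply: ler_wpM2r; first exact: normc_ge0.
by rewrite exprS ler_piMr // exprn_ile1.
Qed.

(** With [x = t / r <= 1/2] the majorant is at most the sum of [M * x^i] over [i >= 1], hence at
    most [2 * M * x], uniformly in [N]. *)
Lemma pnorm_trunc_small (c : nat -> R[i]) (M r e : R) : c 0%N = 0 -> 0 < r -> 0 < e ->
  (forall i, normc (c i) * r ^+ i <= M) ->
  exists2 s : R, 0 < s & forall t N, 0 <= t <= s -> pnorm (\poly_(i < N) c i) t <= e.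
Proof.
move=> c0 r0 e0 cM.
have M0 : 0 <= M by apply: le_trans (cM 0%N); rewrite c0 Normc.normc0 mul0r.
exists (r * Num.min 2^-1 (e / (2 * (M + 1)))) => [|t N /andP[t0]].
  by rewrite mulr_gt0 // lt_min invr_gt0 ltr0n divr_gt0 // mulr_gt0 // ltr_wpDl.
rewrite mulrC -ler_pdivrMr // le_min; set x := t / r => /andP[x1 xe].
have x0 : 0 <= x by rewrite divr_ge0 // ltW.
have tE : t = x * r by rewrite /x divfK // gt_eqF.
rewrite /pnorm (@horner_coef_wide _ N); last first.
  by apply: leq_trans (size_poly _ _) _; exact: size_poly.
case: N => [|N]; first by rewrite big_ord0 ltW.
rewrite big_ord_recl coef_map_normc coef_poly /= c0 Normc.normc0 mul0r add0r.
apply: (@le_trans _ _ (\sum_(i < N) M * x * x ^+ i)).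
  apply: ler_sum => i _; rewrite coef_map_normc coef_poly /bump /= add1n ltnS ltn_ord.
  rewrite tE exprMn [x ^+ _ * _]mulrC mulrA -[M * x * _]mulrA -exprS.
  by apply: ler_wpM2r; [exact: exprn_ge0|exact: cM].
rewrite -mulr_sumr; have x11 : 0 <= x < 1 by rewrite x0; lra.
have := geometric_sum_le N x11; rewrite big_mkord => G.
have G2 : (1 - x)^-1 <= 2 by rewrite invf_ple ?posrE; lra.
apply: (@le_trans _ _ (M * x * 2)).
  by apply: ler_wpM2l; [exact: mulr_ge0|exact: le_trans G G2].
have : x * (2 * (M + 1)) <= e by rewrite -ler_pdivlMr // mulr_gt0 // ltr_wpDl.
nra.
Qed.

Lemma horner_cvg (q : {poly R[i]}) (u : nat -> CC R) w : u @ \oo --> w ->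
  (fun n => q.[u n] : CC R) @ \oo --> (q.[w] : CC R).
Proof.
move=> uw; elim/poly_ind: q => [|q c IH].
  under eq_fun do rewrite horner0; rewrite horner0; exact: cvg_cst.
under eq_fun do rewrite hornerMXaddC; rewrite hornerMXaddC.
exact: cvgD (cvgM IH uw) (cvg_cst _).
Qed.

Lemma horner_derivable (q : {poly R[i]}) w : derivable (fun w : CC R => q.[w] : CC R) w 1.
Proof.
elim/poly_ind: q => [|q c IH].
  have -> : (fun w : CC R => (0 : {poly R[i]}).[w] : CC R) = cst 0 by apply/funext => z;
      rewrite horner0.
  exact: derivable_cst.
have -> : (fun w : CC R => (q * 'X + c%:P).[w] : CC R) =
    (fun w : CC R => q.[w] : CC R) * (fun w : CC R => w) + cst c.
  by apply/funext => z; rewrite hornerMXaddC.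
have did : derivable (fun x : CC R => x) w (1 : CC R) := @derivable_id _ _ w 1.
have dM := derivableM IH did.
have dC := @derivable_cst _ (CC R) (CC R) c w 1.
exact: derivableD dM dC.
Qed.

Lemma cvg_sum_ord (k : nat) (u : 'I_k -> nat -> CC R) (l : 'I_k -> CC R) :
  (forall i, u i @ \oo --> l i) ->
  (fun n => \sum_i u i n) @ \oo --> (\sum_i l i : CC R).
Proof.
elim: k u l => [|k IH] u l ul.
  rewrite big_ord0; under eq_fun do rewrite big_ord0; exact: cvg_cst.
rewrite big_ord_recl; under eq_fun do rewrite big_ord_recl.
exact: cvgD (ul ord0) (IH (fun i => u (lift ord0 i)) (fun i => l (lift ord0 i)) (fun i => ul
    _)).
Qed.

Variables (p : {poly R}) (d : nat) (b : nat -> R) (G : nat -> int).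
Hypotheses (p1 : p`_0 = 1) (d0 : (0 < d)%N) (b2 : forall m, `|b m| <= 2).
Hypothesis GE : forall k,
  (G k)%:~R = \sum_(m < k.+1) b m * (twisted_monomial p d k.+1 m)`_k.

Local Notation toC := (map_poly (real_complex R)).
Let pC := toC p.

(** The range [d * N] splits into [d] full residue classes of [N] terms each, so evaluation yields
    [d] truncated power series. *)
Definition approx_poly N : {poly R} := \sum_(m < d * N) b m *: twisted_monomial p d N m.

Lemma coef_approx_poly N k : (k < N)%N -> (approx_poly N)`_k = (G k)%:~R.
Proof.
move=> kN; have kdN : (k.+1 <= d * N)%N by apply: leq_trans kN _; rewrite leq_pmull.
rewrite GE /approx_poly coef_sum.
rewrite (big_ord_widen (d * N) (fun m => b m * (twisted_monomial p d k.+1 m)`_k)) //.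
rewrite [in RHS]big_mkcond; apply: eq_bigr => m _; rewrite coefZ.
case: ltnP => [mk|km]; last by rewrite twisted_monomial_small ?mulr0.
by rewrite (twisted_monomial_mod p1 d m kN).
Qed.

(** The sum of [b_m X^(m mod d) h^(m div d)] at [w], grouped by the residue [j] of [m] modulo
    [d]. *)
Definition limit_function w : CC R :=
  \sum_(j < d) w ^+ j * psum (fun n => (b (n * d + j))%:C%C) (w ^+ d / pC.[w]).

Lemma pC1 : (1 - pC)`_0 = 0.
Proof. by rewrite coefB coef1 coef_map p1 rmorph1 subrr. Qed.

Lemma toC_approx_poly N : toC (approx_poly N) =
  \sum_(m < d * N) (b m)%:C%C *: ('X^m * inv_trunc pC N ^+ (m %/ d)).
Proof.
rewrite /approx_poly rmorph_sum; apply: eq_bigr => m _.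
rewrite /= map_polyZ rmorphM /= map_polyXn rmorphXn /=; congr (_ *: (_ * _ ^+ _)).
by rewrite /inv_trunc rmorph_sum; apply: eq_bigr => k _; rewrite rmorphXn rmorphB rmorph1.
Qed.

Lemma geometric_half_le N : \sum_(0 <= k < N) 2^-1 ^+ k <= 2 :> R.
Proof.
have half01 : 0 <= (2^-1 : R) < 1 by lra.
by apply: le_trans (geometric_sum_le _ half01) _; rewrite invf_ple ?posrE; lra.
Qed.

Lemma pnorm_inv_trunc t N : 0 <= t -> pnorm (1 - pC) t <= 2^-1 -> pnorm (inv_trunc pC N) t <= 2.
Proof.
move=> t0 pt; apply: le_trans (pnorm_sum _ _ _ t0) _.
apply: (@le_trans _ _ (\sum_(0 <= k < N) 2^-1 ^+ k)).
  rewrite big_mkord; apply: ler_sum => k _; apply: le_trans (pnormX _ _ t0) _.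
  by rewrite lerXn2r // nnegrE ?pnorm_ge0 // invr_ge0.
exact: geometric_half_le.
Qed.

(** The [m]-th term is at most [2 * 4^-m * 2^(m div d) <= 2 * 2^-m], and these bounds add up to at
    most 4. *)
Lemma pnorm_approx_poly t N : 0 <= t <= 4^-1 -> pnorm (1 - pC) t <= 2^-1 ->
  pnorm (toC (approx_poly N)) t <= 4.
Proof.
move=> /andP[t0 t4] pt; rewrite toC_approx_poly; apply: le_trans (pnorm_sum _ _ _ t0) _.
apply: (@le_trans _ _ (\sum_(0 <= m < d * N) 2 * 2^-1 ^+ m)).
  rewrite big_mkord; apply: ler_sum => m _; apply: le_trans (pnormZ _ _ t0) _.
  rewrite normc_real; apply: ler_pM; rewrite ?normr_ge0 ?pnorm_ge0 //.
  apply: le_trans (pnormM _ _ t0) _; rewrite pnorm_Xn.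
  apply: (@le_trans _ _ (4^-1 ^+ m * 2 ^+ m)); last first.
    by rewrite -exprMn; have -> : 4^-1 * 2 = 2^-1 :> R by field.
  apply: ler_pM; rewrite ?exprn_ge0 ?pnorm_ge0 //.
    by rewrite lerXn2r // nnegrE invr_ge0.
  apply: le_trans (pnormX _ _ t0) _; apply: (@le_trans _ _ (2 ^+ (m %/ d))).
    by rewrite lerXn2r // ?nnegrE ?pnorm_ge0 // pnorm_inv_trunc.
  by rewrite ler_weXn2l ?ler1n // leq_div.
rewrite -mulr_sumr; have -> : 4 = 2 * 2 :> R by ring.
rewrite ler_pM2l //; exact: geometric_half_le.
Qed.

Lemma horner_approx_poly N w : (toC (approx_poly N)).[w] =
  \sum_(j < d) w ^+ j * \sum_(0 <= n < N) (b (n * d + j))%:C%C * (w ^+ d * (inv_trunc pC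
      N).[w]) ^+ n.
Proof.
rewrite toC_approx_poly horner_sum.
under eq_bigr do rewrite hornerZ hornerM hornerXn horner_exp.
pose F m : R[i] := (b m)%:C%C * (w ^+ m * (inv_trunc pC N).[w] ^+ (m %/ d)).
rewrite -(big_mkord xpredT F) mulnC big_nat_mul.
transitivity (\sum_(0 <= n < N) \sum_(j < d) F (n * d + j)%N).
  apply: eq_bigr => n _; rewrite mulSn addnC -{1}[(n * d)%N]add0n big_addn.
  by rewrite [(_ + d)%N]addnC addnK big_mkord; apply: eq_bigr => j _; rewrite addnC.
rewrite exchange_big; apply: eq_bigr => j _; rewrite mulr_sumr; apply: eq_bigr => n _.
rewrite /F divnMDl // divn_small // addn0 exprD [w ^+ (n * d)]exprM -exprM mulnC exprM
    exprMn; ring.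
Qed.

(** The argument depends on [N] because the inner series will be truncated at [N] as well. *)
Lemma approx_poly_cvg (u : nat -> CC R) w t : 0 <= t <= 4^-1 ->
  pnorm (1 - pC) t <= 2^-1 -> (forall n, normc (u n) <= t) -> u @ \oo --> w ->
  (fun N => (toC (approx_poly N)).[u N] : CC R) @ \oo --> limit_function w.
Proof.
move=> /andP[t0 t4] pt ut uw.
have wt := normc_lim_le uw ut.
have small y : normc y <= t -> normc (1 - pC.[y]) <= 2^-1.
  move=> yt; have -> : 1 - pC.[y] = (1 - pC).[y] by rewrite hornerD hornerN hornerC.
  apply: le_trans (normc_horner_le _ _) _; apply: le_trans pt.
  by apply: pnorm_le; rewrite normc_ge0.
have nz y : normc y <= t -> pC.[y] != 0.
  move=> /small; apply: contraTneq => ->; rewrite subr0 Normc.normc1 -ltNge invf_lt1 ?ltr1n //.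
pose v N : CC R := (inv_trunc pC N).[u N].
(* Closed form of the finite geometric sum; its power term tends to 0 since [|1 - p| <= 1/2] on the
   disc. *)
have vE N : v N = (1 - (1 - pC.[u N]) ^+ N) / pC.[u N].
  rewrite /v /inv_trunc horner_sum; set y := u N.
  have -> : \sum_(i < N) ((1 - pC) ^+ i).[y] = \sum_(i < N) (1 - pC.[y]) ^+ i.
    by apply: eq_bigr => i _; rewrite horner_exp hornerD hornerN hornerC.
  apply: (canRL (mulfK (nz _ (ut N)))).
  have := subrX1 (1 - pC.[y]) N => E; rewrite mulrC.
  by rewrite -[RHS]opprB E -mulNr; congr (_ * _); rewrite -/y; ring.
have pw : (fun N => pC.[u N] : CC R) @ \oo --> (pC.[w] : CC R) by exact: horner_cvg.
have U0 : (fun N => (1 - pC.[u N]) ^+ N : CC R) @ \oo --> (0 : CC R).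
  apply/cvg_normcP => e e0.
  have /cvgr0Pnorm_lt /(_ e e0) : (geometric 1 2^-1) @ \oo --> (0 : R).
    by apply: cvg_geometric; rewrite ger0_norm // invf_lt1 // ltr1n.
  apply: filterS => n; rewrite subr0 /geometric /= mul1r ger0_norm ?exprn_ge0 //.
  apply: le_lt_trans; rewrite normcX lerXn2r ?nnegrE ?normc_ge0 ?invr_ge0 //.
  exact/small.
have vw : v @ \oo --> (1 / pC.[w] : CC R).
  have -> : v = (fun N => (1 - (1 - pC.[u N]) ^+ N) / pC.[u N]) by apply/funext.
  have lim0 := cvgM (cvgB (cvg_cst (1 : CC R)) U0) (cvgV (nz _ wt) pw).
  by rewrite subr0 in lim0; exact: lim0.
have Xcvg k : (fun N => u N ^+ k) @ \oo --> w ^+ k.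
  have := @horner_cvg 'X^k _ _ uw; rewrite hornerXn.
  by under eq_fun do rewrite hornerXn.
have hw : (fun N => u N ^+ d * v N) @ \oo --> w ^+ d / pC.[w].
  by have lim0 := cvgM (Xcvg d) vw; rewrite mul1r in lim0; exact: lim0.
(* From [t^d <= t <= 1/4] (as [d > 0]) and the bound 2 on the truncated inverse; it provides the
   uniform radius below 1 for [psum_diagonal]. *)
have hb N : normc (u N ^+ d * v N) <= 2^-1.
  rewrite Normc.normcM normcX; apply: (@le_trans _ _ (4^-1 * 2)); last lra.
  apply: ler_pM; rewrite ?exprn_ge0 ?normc_ge0 //.
    apply: (@le_trans _ _ (t ^+ d)); first by rewrite lerXn2r ?nnegrE ?normc_ge0.
    case: (d) d0 => // k _; rewrite exprS; apply: le_trans (t4); rewrite ler_piMr //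
        exprn_ile1 //.
    by apply: le_trans t4 _; rewrite invf_le1 // ler1n.
  apply: le_trans (normc_horner_le _ _) _.
  apply: (@le_trans _ _ (pnorm (inv_trunc pC N) t)); last exact: pnorm_inv_trunc.
  by apply: pnorm_le; rewrite normc_ge0 ut.
under eq_fun do rewrite horner_approx_poly.
apply: cvg_sum_ord => j.
have h1 : 2^-1 < 1 :> R by rewrite invf_lt1 ?ltr1n.
have bC n : normc (b (n * d + j))%:C%C <= 2 by rewrite normc_real.
exact: cvgM (Xcvg j) (psum_diagonal bC h1 hw hb).
Qed.

(** The composites of [approx_poly N] with the truncations of [c] meet the hypotheses of
    [series_of_truncations]. Halving [s] lets the majorant be taken at radius [2 * |z|]. *)
Lemma series_comp_cvg (c : nat -> R[i]) (M r : R) : c 0%N = 0 -> 0 < r ->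
  (forall i, normc (c i) * r ^+ i <= M) ->
  exists2 e : R, 0 < e & forall z w, normc z < e ->
    series (fun n => c n * z ^+ n : CC R) @ \oo --> w ->
    series (fun n => fps_comp (fun k => (G k)%:~R) c n * z ^+ n : CC R) @ \oo -->
        limit_function w.
Proof.
move=> c0 r0 cM.
have [s1 s10 S1] := pnorm_small pC1 (ltac:(rewrite invr_gt0 ltr0n //) : 0 < 2^-1 :> R).
pose t := Num.min 4^-1 s1.
have t0 : 0 < t by rewrite lt_min s10 invr_gt0 ltr0n.
have t4 : 0 <= t <= 4^-1 by rewrite (ltW t0) ge_min lexx.
have ts : 0 <= t <= s1 by rewrite (ltW t0) ge_min lexx orbT.
have pt := S1 t ts.
have [s s0 S] := pnorm_trunc_small c0 r0 t0 cM.
exists (s / 2) => [|z w zs cw]; first by rewrite divr_gt0.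
have z0 := normc_ge0 z.
have z2s : 0 <= 2 * normc z <= s by rewrite mulr_ge0 //=; lra.
have z1s : 0 <= normc z <= s by rewrite z0 /=; lra.
pose P N := \poly_(i < N) c i.
have PzE N : (P N).[z] = series (fun n => c n * z ^+ n : CC R) N.
  by rewrite /P horner_poly /series /= big_mkord.
apply: (series_of_truncations (A := fun N => toC (approx_poly N) \Po P N) (K := 4)).
- move=> N k kN; apply: (coef_comp_poly_fps (N := N)) => //.
  + by rewrite coef_poly c0 if_same.
  + by move=> i iN; rewrite coef_map coef_approx_poly //= rmorph_int.
  + by move=> i iN; rewrite coef_poly iN.
- move=> N; apply: le_trans (pnorm_comp _ _ _) _; first by case/andP: z2s.
  apply: (@le_trans _ _ (pnorm (toC (approx_poly N)) t)); last exact: pnorm_approx_poly.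
  apply: pnorm_le; rewrite S // pnorm_ge0 //; by case/andP: z2s.
- under eq_fun do rewrite horner_comp.
  apply: (approx_poly_cvg t4 pt).
    by move=> N; apply: le_trans (normc_horner_le _ _) _; exact: S.
  by under eq_fun do rewrite PzE.
Qed.

Lemma horner_ratio_derivable w : pC.[w] != 0 ->
  derivable (fun w : CC R => w ^+ d / pC.[w] : CC R) w 1.
Proof.
move=> pw; have d1 := @horner_derivable 'X^d w; have d2 := @horner_derivable pC w.
have -> : (fun w : CC R => w ^+ d / pC.[w] : CC R) =
    (fun w : CC R => ('X^d : {poly R[i]}).[w] : CC R) * (fun w : CC R => (pC.[w])^-1 : CC R).
  by apply/funext => z; rewrite -[z ^+ d]hornerXn.
exact: derivableM d1 (derivableV pw d2).
Qed.

Lemma horner_ratio_open :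
  open [set w : CC R | pC.[w] != 0 /\ normc (w ^+ d / pC.[w]) < 1].
Proof.
rewrite openE; move=> w [pw hw]; apply: filterI.
  have /derivableP/is_derive_cts/cts_normcP := @horner_derivable pC w.
  have nw : 0 < normc pC.[w] by rewrite normc_gt0.
  move=> /(_ _ nw) [e e0 eP]; apply/nbhs_normcP; exists e => // v /eP.
  by apply: contraTneq => ->; rewrite sub0r normcN ltxx.
have /derivableP/is_derive_cts/cts_normcP := horner_ratio_derivable pw.
have nw : 0 < 1 - normc (w ^+ d / pC.[w]) by rewrite subr_gt0.
move=> /(_ _ nw) [e e0 eP]; apply/nbhs_normcP; exists e => // v /eP H.
rewrite -[v ^+ d / _](subrK (w ^+ d / pC.[w])).
by apply: le_lt_trans (normcD _ _) _; rewrite -ltrBrDr.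
Qed.

Lemma limit_function_derivable w : pC.[w] != 0 -> normc (w ^+ d / pC.[w]) < 1 ->
  derivable limit_function w 1.
Proof.
move=> pw hw; pose h (w : CC R) : CC R := w ^+ d / pC.[w].
have dh : derivable h w 1 := horner_ratio_derivable pw.
pose g (j : 'I_d) (w : CC R) : CC R := w ^+ j * psum (fun n => (b (n * d + j))%:C%C) (h w).
have dg j : derivable (g j) w 1.
  have d1 := @horner_derivable 'X^j w.
  have bC n : normc (b (n * d + j))%:C%C <= 2 by rewrite normc_real.
  have d2 := derivable_comp dh (psum_derivable bC hw).
  have -> : g j = (fun w : CC R => ('X^j : {poly R[i]}).[w] : CC R) * (psum (fun n => (b (n *
      d + j))%:C%C) \o h).
    by apply/funext => z; rewrite /g -[z ^+ j]hornerXn.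
  exact: derivableM d1 d2.
have -> : limit_function = \sum_j g j by apply/funext => z; rewrite fct_sumE.
exact: derivable_sum.
Qed.

End Germ.

(** * Cardinality *)

Section Continuum.

Lemma card_le_injective (T U : Type) (A : set T) (B : set U) (f : T -> U) :
  (forall x, A x -> B (f x)) -> (forall x y, A x -> A y -> f x = f y -> x = y) -> A #<= B.
Proof.
move=> fB finj; have fi : {in A &, injective f} by move=> x y; rewrite !inE; exact: finj.
apply: card_le_trans (subset_card_le (A := f @` A) (B := B) _); last by move=> _ [x /fB ? <-].
by have /card_eqPle[] := inj_card_eq fi.
Qed.

(** A sequence is encoded by its graph, a subset of the countable [nat * int]. *)
Lemma card_le_int_seq_bool_seq : [set: nat -> int] #<= [set: nat -> bool].
Proof.
apply: (@card_le_injective _ _ _ _ (fun g n => if unpickle n is Some (k, z) then g k == z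
    else false)) => // g g' _ _ gg.
apply/funext => k; have := congr1 (fun s => s (pickle (k, g k))) gg.
by rewrite !pickleK eqxx => /esym/eqP ->.
Qed.

Context {R : realType}.

(** Dedekind cuts: a real is encoded by the set of rationals below it. *)
Lemma card_le_real_bool_seq : [set: R] #<= [set: nat -> bool].
Proof.
apply: (@card_le_injective _ _ _ _ (fun (x : R) n => if unpickle n is Some q then ratr q < x
    else false)) => // x y _ _ xy.
have E q : (ratr q < x) = (ratr q < y).
  by have := congr1 (fun s => s (pickle q)) xy; rewrite !pickleK.
case: (ltgtP x y) => // [/rat_in_itvoo|/rat_in_itvoo] [q]; rewrite in_itv /= => /andP[A B].
  by move: A; rewrite ltNge ltW // E.
by move: A; rewrite ltNge ltW // -E.
Qed.

(** In base 3 with digits 0 and 1 everything after a place amounts to at most half a unit of that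
    place, so no real has two expansions. *)
Let ternary_sum (s : nat -> bool) n : R := \sum_(0 <= i < n) (s i)%:R * 3^-1 ^+ i.

Let ternary s : R := sup (range (ternary_sum s)).

(** The added [3 / 2 * 3^-n] is the value of digits 1 in all places from [n] on; fixing further
    digits can only lower the total. *)
Lemma ternary_sum_bound s m n : (m <= n)%N ->
  ternary_sum s n + 3 / 2 * 3^-1 ^+ n <= ternary_sum s m + 3 / 2 * 3^-1 ^+ m.
Proof.
elim: n => [|n IH]; first by rewrite leqn0 => /eqP ->.
rewrite leq_eqVlt => /orP[/eqP -> //|/IH]; apply: le_trans.
rewrite /ternary_sum big_nat_recr //= exprS.
have : 0 <= 3^-1 ^+ n :> R by rewrite exprn_ge0 // invr_ge0.
by case: (s n) => /=; lra.
Qed.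

Lemma ternary_has_ubound s : has_ubound (range (ternary_sum s)).
Proof.
exists (3 / 2) => _ [n _ <-].
have := @ternary_sum_bound s 0 n (leq0n n); rewrite {2}/ternary_sum big_geq // expr0.
have : 0 <= 3^-1 ^+ n :> R by rewrite exprn_ge0 // invr_ge0.
lra.
Qed.

Lemma ternary_lt s s' m : (forall i, (i < m)%N -> s i = s' i) -> ~~ s m -> s' m ->
  ternary s < ternary s'.
Proof.
move=> ss sm sm'; have p3 : 0 < 3^-1 ^+ m :> R by rewrite exprn_gt0 // invr_gt0.
have Em : ternary_sum s m = ternary_sum s' m by apply: eq_big_nat => i /andP[_ /ss ->].
have A : ternary s <= ternary_sum s m + 2^-1 * 3^-1 ^+ m.
  apply: ge_sup; first by exists (ternary_sum s 0); exists 0%N.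
  move=> _ [n _ <-].
  have S1 : ternary_sum s m.+1 = ternary_sum s m.
    by rewrite /ternary_sum big_nat_recr //= (negbTE sm) mul0r addr0.
  have [mn|nm] := ltnP m n.
    have := ternary_sum_bound s mn; rewrite S1 exprS.
    have : 0 <= 3^-1 ^+ n :> R by rewrite exprn_ge0 // invr_ge0.
    lra.
  have : ternary_sum s n <= ternary_sum s m.
    rewrite /ternary_sum (big_cat_nat (leq0n n) nm) /= lerDl.
    by apply: sumr_ge0 => i _; apply: mulr_ge0; [exact: ler0n|rewrite exprn_ge0 // invr_ge0].
  lra.
have B : ternary_sum s m + 3^-1 ^+ m <= ternary s'.
  have -> : ternary_sum s m + 3^-1 ^+ m = ternary_sum s' m.+1.
    by rewrite Em [in RHS]/ternary_sum big_nat_recr //= sm' mul1r.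
  by apply: ub_le_sup; [exact: ternary_has_ubound|exists m.+1].
lra.
Qed.

Lemma card_le_bool_seq_real : [set: nat -> bool] #<= [set: R].
Proof.
apply: (@card_le_injective _ _ _ _ ternary) => // s s' _ _ E.
apply/funext; apply: contrapT => /existsNP[k /eqP kP].
have ex : exists k, s k != s' k by exists k.
have [m mP mmin] := ex_minnP ex.
have ss i : (i < m)%N -> s i = s' i.
  by move=> im; apply/eqP; apply: contraTT im => /mmin; rewrite -leqNgt.
have ss' i : (i < m)%N -> s' i = s i by move=> /ss.
move: mP; case sm : (s m); case sm' : (s' m) => // _.
  by have := ternary_lt ss' (negbT sm') sm; rewrite E ltxx.
by have := ternary_lt ss (negbT sm) sm'; rewrite E ltxx.
Qed.

Lemma card_eq_continuum (A : set (nat -> int)) (f : (nat -> bool) -> nat -> int) :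
  injective f -> (forall s, A (f s)) -> A #= [set: R].
Proof.
move=> finj fA; apply/card_eqPle; split.
  apply: card_le_trans (card_leT A) _.
  exact: card_le_trans card_le_int_seq_bool_seq card_le_bool_seq_real.
apply: card_le_trans card_le_real_bool_seq _.
by apply: (@card_le_injective _ _ _ _ f) => // s s' _ _; exact: finj.
Qed.

End Continuum.

(** * Riemann surfaces *)

Section Surface.
Context {R : realType}.

Lemma disc_connected (c : CC R) (e : R) : connected [set w : CC R | normc (w - c) < e].
Proof.
have [e0|e0] := leP e 0.
  have -> : [set w : CC R | normc (w - c) < e] = set0.
    by apply/seteqP; split=> // w /= /lt_le_trans /(_ e0); rewrite ltNge normc_ge0.
  exact: connected0.
pose seg (w : CC R) := (fun t : R => c + t%:C%C * (w - c)) @` `[0, 1].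
have segC w : connected (seg w).
  apply: connected_continuous_connected; first exact: segment_connected.
  apply: continuous_subspaceT => t; apply/cvg_normcP => x x0.
  apply/nbhs_ballP; exists (x / (normc (w - c) + 1)) => /= [|t' tt].
    by rewrite divr_gt0 // ltr_wpDl // normc_ge0.
  have -> : c + t'%:C%C * (w - c) - (c + t%:C%C * (w - c)) = (t' - t)%:C%C * (w - c).
    by rewrite rmorphB /=; ring.
  rewrite Normc.normcM normc_real; move: tt; rewrite /ball /= distrC ltr_pdivlMr ?ltr_wpDl
      ?normc_ge0 //.
  by apply: le_lt_trans; rewrite ler_wpM2l // lerDl.
have -> : [set w : CC R | normc (w - c) < e] = \bigcup_(w in [set w : CC R | normc (w - c) <
    e]) seg w.
  apply/seteqP; split=> [w we|v [w /= we [t]]].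
    by exists w => //; exists 1; rewrite /= ?in_itv /= ?ler01 ?lexx // rmorph1 mul1r addrC
        subrK.
  rewrite /= in_itv /= => /andP[t0 t1] <-; rewrite addrAC subrr add0r Normc.normcM normc_real
      ger0_norm //.
  by apply: le_lt_trans we; rewrite ler_piMl // normc_ge0.
apply: bigcup_connected => [|w _]; last exact: segC.
by exists c => w _; exists 0; rewrite /= ?in_itv /= ?ler01 ?lexx // rmorph0 mul0r addr0.
Qed.

Section Charts.
Context {M : topologicalType} (k : chart R M).

Lemma cmap_cinv w : (cmap k @` cdom k) w -> cdom k (cinv k w) /\ cmap k (cinv k w) = w.
Proof. by move=> [y ky <-]; rewrite cmapK. Qed.

Lemma cmap_image w y : cdom k y -> cmap k y = w -> (cmap k @` cdom k) w.
Proof. by move=> ky <-; exists y. Qed.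

Lemma chart_near x (P : set M) : cdom k x -> nbhs x P ->
  exists2 e : R, 0 < e & forall w, normc (w - cmap k x) < e ->
    [/\ cdom k (cinv k w), cmap k (cinv k w) = w & P (cinv k w)].
Proof.
move=> kx Px; have kxi : (cmap k @` cdom k) (cmap k x) by exists x.
have /nbhs_normcP[e1 e10 H1] : nbhs (cmap k x) (cmap k @` cdom k).
  by apply: open_nbhs_nbhs; split=> //; exact: cimg_open.
have /nbhs_normcP[e2 e20 H2] : nbhs (cmap k x) (cinv k @^-1` P).
  by apply: (cinv_cont kxi); rewrite cmapK.
exists (Num.min e1 e2) => [|w]; first by rewrite lt_min e10.
rewrite lt_min => /andP[/H1/cmap_cinv[? ?] /H2 ?]; by split.
Qed.

Lemma chart_nbhs x (e : R) : cdom k x -> 0 < e ->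
  nbhs x [set y | cdom k y /\ normc (cmap k y - cmap k x) < e].
Proof.
move=> kx e0; apply: filterI.
  by apply: open_nbhs_nbhs; split=> //; exact: cdom_open.
have Q : nbhs (cmap k x) [set w : CC R | normc (w - cmap k x) < e].
  by apply/nbhs_normcP; exists e.
exact: cmap_cont kx _ Q.
Qed.

Definition chart_disc x (e : R) := [set y | cdom k y /\ normc (cmap k y - cmap k x) < e].

Lemma chart_disc_open x e : open (chart_disc x e).
Proof.
rewrite openE; move=> y [ky ye]; rewrite /interior.
have e0 : 0 < e - normc (cmap k y - cmap k x) by rewrite subr_gt0.
apply: filterS (chart_nbhs ky e0) => y' [ky' H]; split=> //.
have -> : cmap k y' - cmap k x = (cmap k y' - cmap k y) + (cmap k y - cmap k x) by rewrite
    addrA subrK.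
by apply: le_lt_trans (normcD _ _) _; rewrite -ltrBrDr.
Qed.

End Charts.

Context {S : riemann_surface R}.
Implicit Types (U V W : set S) (F : S -> CC R) (K : CC R -> CC R).

(** Coordinate discs inside [U] are attached to [V] at each of its points. This supplies the
    connected neighborhood demanded by [holomorphic_near_V], where the estimates yield merely an
    open one. *)
Lemma connected_open_refine V U : V !=set0 -> connected V -> open U -> V `<=` U ->
  exists W, [/\ open W, connected W, V `<=` W & W `<=` U].
Proof.
move=> [x0 Vx0] cV oU VU.
have step x : exists D : set S, V x -> [/\ open D, connected D, D x & D `<=` U].
  have [Vx|nVx] := pselect (V x); last by exists set0.
  have [k ak kx] := rs_cover x.
  have xU : nbhs x U by apply: open_nbhs_nbhs; split=> //; exact: VU.
  have [e e0 eP] := chart_near kx xU.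
  have DE : chart_disc k x e = cinv k @` [set w : CC R | normc (w - cmap k x) < e].
    apply/seteqP; split=> [y [ky ye]|y [w /= we <-]].
      by exists (cmap k y) => //; exact: cmapK.
    by have [? E ?] := eP w we; split=> //; rewrite E.
  exists (chart_disc k x e); move=> _; split.
  - exact: chart_disc_open.
  - rewrite DE; apply: connected_continuous_connected; first exact: disc_connected.
    apply: continuous_in_subspaceT => w; rewrite inE /= => we.
    have [kw E _] := eP w we; apply: cinv_cont; exact: cmap_image kw E.
  - by split=> //; rewrite subrr Normc.normc0.
  - by rewrite DE => _ [w /= /eP[_ _ ?] <-].
have [D DP] := choice step.
exists (\bigcup_(x in V) (V `|` D x)).
have VD : V `<=` \bigcup_(x in V) D x by move=> x Vx; exists x => //; have [] := DP x Vx.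
split.
- have -> : \bigcup_(x in V) (V `|` D x) = \bigcup_(x in V) D x.
    apply/seteqP; split=> [y [x Vx [/VD //|Dy]]|y [x Vx Dy]]; first by exists x.
    by exists x => //; right.
  by apply: bigcup_open => x /DP[].
- apply: bigcup_connected; first by exists x0 => x Vx; left.
  move=> x Vx; have [_ cD Dx _] := DP x Vx.
  by apply: connectedU => //; exists x.
- by move=> x Vx; exists x => //; left.
- move=> y [x Vx [/VU //|]]; have [_ _ _ DU] := DP x Vx; exact: DU.
Qed.

Lemma holomorphic_continuous U F x : holomorphic_on U F -> U x -> {for x, continuous F}.
Proof.
move=> hF Ux P PF; have [k ak kx] := rs_cover x.
have /derivableP/is_derive_cts cF := hF x k Ux ak kx.
have /nbhs_normcP[e e0 eP] : nbhs (cmap k x) ((F \o cinv k) @^-1` P).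
  by apply: cF; rewrite /= cmapK.
apply: filterS (chart_nbhs kx e0) => y [ky ye].
by have := eP _ ye; rewrite /= cmapK.
Qed.

Lemma holomorphic_comp U F K : holomorphic_on U F ->
  (forall x, U x -> derivable K (F x) 1) -> holomorphic_on U (K \o F).
Proof.
move=> hF dK x k Ux ak kx.
have -> : (K \o F) \o cinv k = K \o (F \o cinv k) by [].
by apply: derivable_comp; [exact: hF|rewrite /= cmapK //; exact: dK].
Qed.

Lemma holomorphic_sub U W F : W `<=` U -> holomorphic_on U F -> holomorphic_on W F.
Proof. by move=> WU hF x k /WU; exact: hF. Qed.

(* [F] and its conjugate by [s] agree on a relatively closed and open subset of [V]. *)
Lemma antiholomorphic_identity V W F (s : S -> S) o : antiholomorphic s ->
  open W -> V `<=` W -> (forall x, V x -> V (s x)) -> connected V -> V o ->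
  holomorphic_on W F ->
  (\forall x \near o, F (s x) = (F x)^*%C) ->
  V `<=` interior [set x | F (s x) = (F x)^*%C].
Proof.
move=> [cs hs] oW VW sV cV Vo hF Fo; set E := [set x | F (s x) = _].
suff <- : V `&` interior E = V by move=> x [].
apply: cV; first by exists o.
  by exists (interior E) => //; exact: open_interior.
exists (closure (interior E)); first exact: closed_closure.
apply/seteqP; split=> x [Vx Ex]; split=> //; first exact: subset_closure.
have [k ak kx] := rs_cover x; have [l al lx] := rs_cover (s x).
have Wnear y : V y -> nbhs y W by move=> /VW Wy; apply: open_nbhs_nbhs; split.
have Nx : nbhs x [set y | [/\ W y, cdom l (s y) & W (s y)]].
  have A : nbhs x W by exact: Wnear.
  have B : nbhs x (s @^-1` cdom l).
    by apply: cs; apply: open_nbhs_nbhs; split=> //; exact: cdom_open.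
  have C : nbhs x (s @^-1` W) by apply: cs; apply: Wnear; exact: sV.
  by apply: filterS (filterI (filterI A B) C) => y [[]].
have [e e0 eP] := chart_near kx Nx.
(* In charts the conjugate of [F o s] is the conjugated expression of [s], holomorphic by
   hypothesis, followed by the reflection of [F]; so [G] is holomorphic. *)
pose G (w : CC R) : CC R := F (cinv k w) - (F (s (cinv k w)))^*%C.
have dG w : normc (w - cmap k x) < e -> derivable G w 1.
  move=> we; have [kw kwE [Ww lsw Wsw]] := eP w we.
  have d1 : derivable (F \o cinv k) w (1 : CC R).
    by rewrite -{1}kwE; exact: hF.
  pose L (v : CC R) : CC R := (cmap l (s (cinv k v)))^*%C.
  have d2 : derivable L w (1 : CC R) by rewrite -{1}kwE; exact: hs.
  have d3 : derivable (fun v : CC R => ((F \o cinv l) v^*%C)^*%C : CC R) (L w) 1.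
    by apply: derivable_conj; exact: hF.
  have d4 := derivable_comp d2 d3.
  have d5 : derivable (fun v : CC R => (F (s (cinv k v)))^*%C : CC R) w (1 : CC R).
    apply: derivable_ext d4; apply/nbhs_normcP.
    exists (e - normc (w - cmap k x)) => [|v ve]; first by rewrite subr_gt0.
    have /eP[kv kvE [Wv lsv Wsv]] : normc (v - cmap k x) < e.
      have -> : v - cmap k x = (v - w) + (w - cmap k x) by rewrite addrA subrK.
      by apply: le_lt_trans (normcD _ _) _; rewrite -ltrBrDr.
    by rewrite /L /= conjcK cmapK.
  exact: derivableB d1 d5.
(* The identity theorem on the disc of radius [r] about [y] needs holomorphy up to [3 * r]; as [y]
   is within [r] of [x], this stays inside the disc of radius [4 * r = e]. *)
pose r := e / 4; have r0 : 0 < r by rewrite divr_gt0.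
have [y [Ey [ky yr]]] := Ex _ (chart_nbhs kx r0).
have yr' : normc (cmap k x - cmap k y) < r by rewrite normcB.
have [d d0 dP] := chart_near ky Ey.
have key := @holomorphic_identity R (fun w => G (cmap k y + w)) r d d0.
have Gr w : normc w < r -> G (cmap k y + w) = 0.
  apply: key => [{}w wr|{}w wd].
    have dsh : derivable (fun v : CC R => cmap k y + v) w (1 : CC R).
      exact: derivableD (@derivable_cst _ (CC R) (CC R) (cmap k y) w 1) (@derivable_id _ _ w 1).
    apply: (derivable_comp dsh); apply: dG.
    have -> : cmap k y + w - cmap k x = (cmap k y - cmap k x) + w by rewrite addrAC.
    by apply: le_lt_trans (normcD _ _) _; move: wr yr; rewrite /r; clear; lra.
  have [|_ _ H] := dP (cmap k y + w); first by rewrite addrAC subrr add0r.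
  by rewrite /G [F (s _)]H conjcK subrr.
have d1 : 0 < r - normc (cmap k x - cmap k y) by rewrite subr_gt0.
apply: filterS (chart_nbhs kx d1) => v [kv vd].
have := Gr (cmap k v - cmap k y); rewrite [cmap k y + _]addrC subrK /G cmapK // => H.
have /H /eqP : normc (cmap k v - cmap k y) < r.
  have -> : cmap k v - cmap k y = (cmap k v - cmap k x) + (cmap k x - cmap k y) by rewrite
      addrA subrK.
  by apply: le_lt_trans (normcD _ _) _; rewrite -ltrBrDr.
by rewrite subr_eq0 => /eqP Fv; rewrite /E /= Fv conjcK.
Qed.

End Surface.

(** * Conclusion *)

Section FormalOrder.
Context {A : comNzRingType}.
Implicit Types (p : {poly A}) (f g h : nat -> A).

Lemma coef_exp_order p e m k : (forall i, (i < e)%N -> p`_i = 0) -> (k <= e * m)%N ->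
  (p ^+ m)`_k = if k == (e * m)%N then p`_e ^+ m else 0.
Proof.
move=> p0 km; pose q := \poly_(i < size p) p`_(i + e).
have -> : p = 'X^e * q.
  apply/polyP => i; rewrite coefXnM; case: ltnP => [/p0 //|ei].
  rewrite coef_poly subnK //; case: ltnP => // si.
  by rewrite nth_default // (leq_trans si) // leq_subr.
rewrite exprMn -exprM coefXnM coefXnM ltnn subnn -coef0_exp.
by case: ltngtP km => // ->; rewrite subnn.
Qed.

Lemma fps_comp_order f h e : (forall n, (n < e)%N -> f n = 0) -> h 0%N = 0 ->
  fps_comp f h e = f e * h 1%N ^+ e.
Proof.
move=> f0 h0; rewrite /fps_comp coef_sum big_ord_recr /= big1 ?add0r; last first.
  by move=> i _; rewrite f0 // scale0r coef0.
rewrite coefZ (@coef_exp_order _ 1) ?mul1n // ?eqxx; last first.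
  by case=> // _; rewrite coef_poly h0.
case: e f0 => [|e] f0; first by rewrite !expr0.
by rewrite coef_poly.
Qed.

(** As [h^i] starts with [X^(e * i)], the coefficient of degree [e * m] is [f m] plus terms in [f i]
    with [i < m]. *)
Lemma fps_comp_inj f g h e : (0 < e)%N -> (forall n, (n < e)%N -> h n = 0) -> h e = 1 ->
  fps_comp f h = fps_comp g h -> f = g.
Proof.
move=> e0 h0 he fg; apply/funext => m; elim/ltn_ind: m => m IH.
have [->|m0] := posnP m.
  by have := congr1 (fun u => u 0%N) fg; rewrite !fps_comp0.
have em : (e <= e * m)%N by rewrite leq_pmulr.
have := congr1 (fun u => u (e * m)%N) fg; rewrite /fps_comp.
set Q := \poly_(i < _) h i.
have Q0 i : (i < e)%N -> Q`_i = 0.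
  by move=> ie; rewrite coef_poly h0 // if_same.
have Qe : Q`_e = 1 by rewrite coef_poly ltnS em.
have mem : (m < (e * m).+1)%N by rewrite ltnS leq_pmull.
rewrite !coef_sum (bigD1 (Ordinal mem)) //= [in RHS](bigD1 (Ordinal mem)) //=.
rewrite !coefZ (coef_exp_order Q0) // eqxx Qe expr1n !mulr1.
suff -> : \sum_(i < (e * m).+1 | i != Ordinal mem) (f i *: Q ^+ i)`_(e * m) =
          \sum_(i < (e * m).+1 | i != Ordinal mem) (g i *: Q ^+ i)`_(e * m) by move=> /addIr.
apply: eq_bigr => i; rewrite -val_eqE /= => im; rewrite !coefZ.
have [/IH -> //|mi] := ltnP i m.
have {}mi : (m < i)%N by rewrite ltn_neqAle eq_sym im.
rewrite (coef_exp_order Q0); last by rewrite leq_pmul2l // ltnW.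
by rewrite ltn_eqF ?mulr0 // ltn_pmul2l.
Qed.

End FormalOrder.

Section ReversedPolynomial.
Context {F : fieldType}.

Definition rev_poly (p : {poly F}) : {poly F} := \poly_(i < size p) p`_((size p).-1 - i).

Lemma coef0_rev_poly p : p \is monic -> (rev_poly p)`_0 = 1.
Proof.
move=> pm; rewrite coef_poly lt0n size_poly_eq0 monic_neq0 // subn0.
exact/eqP.
Qed.

Lemma horner_rev_poly p x : x != 0 -> (rev_poly p).[x] = x ^+ (size p).-1 * p.[x^-1].
Proof.
move=> x0; rewrite horner_poly horner_coef mulr_sumr.
rewrite (reindex_inj rev_ord_inj) /=; apply: eq_bigr => i _.
have ip : (i <= (size p).-1)%N by rewrite -ltnS (leq_trans (ltn_ord i)) // leqSpred.
have sp : (0 < size p)%N by apply: leq_ltn_trans (ltn_ord i).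
have -> : (size p - i.+1 = (size p).-1 - i)%N by rewrite -subn1 -subnDA add1n.
rewrite subKn // mulrCA exprVn expfB_cond ?(negbTE x0) //.
Qed.

End ReversedPolynomial.

(** * Germs on a formal-analytic surface and the conclusion *)

Section Surfaces.
Context {R : realType} (D : formal_analytic_surface R).
Local Notation V := (bs_V (b := D)).
Local Notation O := (fa_O D).
Local Notation z := (cmap (fa_z D)).
Implicit Types F : D -> CC R.

Lemma fa_O_V : V O.
Proof. exact: interior_subset (fa_O_interior D). Qed.

(** Convergence at a single point with [z = e / 2] bounds the terms: from index [N] on they are
    differences of two partial sums within 1 of the limit, hence below 2. *)
Lemma taylor_coef_bound F a : taylor_at_O F a ->
  exists r M : R, 0 < r /\ forall i, normc (a i) * r ^+ i <= M.
Proof.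
move=> FT; have [e e0 eP] := chart_near (fa_z_dom D) FT.
pose t : CC R := (e / 2)%:C%C.
have nt : normc t = e / 2 by rewrite normc_real ger0_norm // divr_ge0 // ltW.
have te : normc (t - z O) < e by rewrite fa_z_O subr0 nt; lra.
have [_ zt /cvg_normcP /(_ 1 ltr01) [N _ NP]] := eP t te.
rewrite /= zt in NP; exists (e / 2), (2 + \sum_(i < N) normc (a i) * (e / 2) ^+ i).
split=> [|i]; first by rewrite divr_gt0.
have p0 j : 0 <= normc (a j) * (e / 2) ^+ j by rewrite mulr_ge0 ?normc_ge0 // exprn_ge0 //
    divr_ge0 // ltW.
have [iN|Ni] := ltnP i N.
  rewrite (bigD1 (Ordinal iN)) //= addrCA lerDl addr_ge0 // sumr_ge0 //.
rewrite -nt -normcX -Normc.normcM.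
have -> : a i * t ^+ i = (series (fun n => a n * t ^+ n : CC R) i.+1 - F (cinv (fa_z D) t)) -
   (series (fun n => a n * t ^+ n : CC R) i - F (cinv (fa_z D) t)).
  by rewrite /series /= big_nat_recr //=; ring.
apply: le_trans (normcD _ _) _; rewrite normcN.
have N1 := NP i.+1 (leqW Ni); have N2 := NP i Ni.
have S0 : 0 <= \sum_(j < N) normc (a j) * normc t ^+ j by rewrite sumr_ge0 // => j _; rewrite
    nt.
by move: N1 N2 S0; clear; lra.
Qed.

Lemma sigma_near (P : set D) : nbhs O P -> nbhs O (@fa_sigma R D @^-1` P).
Proof. by move=> OP; apply: (fa_sigma_anti D).1; rewrite fa_sigma_O. Qed.

(** Since [z o sigma] is the conjugate of [z], real coefficients make the partial sums at [sigma x]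
    conjugate to those at [x]. *)
Lemma taylor_real F a : (forall i, (a i)^*%C = a i) -> taylor_at_O F a ->
  \forall x \near O, F (fa_sigma x) = (F x)^*%C.
Proof.
move=> ar FT; apply: filterS (filterI (filterI FT (sigma_near FT)) (fa_z_sigma D)).
move=> x [[/= F1 F2] zx]; apply: CC_cvg_unique F2 _; rewrite zx.
apply/cvg_normcP => e e0; move/cvg_normcP: F1 => /(_ e e0); apply: filterS => n.
suff -> : series (fun n => a n * (z x)^*%C ^+ n : CC R) n = (series (fun n => a n * z x ^+ n
    : CC R) n)^*%C.
  by rewrite -rmorphB normc_conj.
by rewrite /series /= rmorph_sum; apply: eq_bigr => i _; rewrite rmorphM rmorphXn /= ar.
Qed.

Lemma formal_germ_real f i : (formal_germ D f i)^*%C = formal_germ D f i.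
Proof.
rewrite /formal_germ -[LHS]/((conjc : {rmorphism R[i] -> R[i]}) _) fps_comp_morph.
congr (fps_comp _ _ i); apply/funext => n /=; last exact: fa_phi_real.
exact: rmorph_int.
Qed.

Lemma sigma_real_of_holomorphic f F : holomorphic_near_V (formal_germ D f) F -> sigma_real F.
Proof.
move=> [W [oW _ VW hF FT]]; exists (interior [set x | F (fa_sigma x) = (F x)^*%C]).
split; first exact: open_interior.
  apply: (antiholomorphic_identity (fa_sigma_anti D) oW VW _ (@bs_connected _ D) fa_O_V hF).
    by move=> x Vx; rewrite -(fa_sigma_V D); exists x.
  exact: taylor_real (formal_germ_real f) FT.
by move=> x /interior_subset.
Qed.

Lemma formal_germ_comp g f : f 0%N = 0 ->
  formal_germ D (fps_comp g f) = fps_comp (fun n => (g n)%:~R) (formal_germ D f).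
Proof.
move=> f0; rewrite /formal_germ.
have -> : (fun n => (fps_comp g f n)%:~R : R[i]) =
    fps_comp (fun n => (g n)%:~R) (fun n => (f n)%:~R).
  apply/funext => n; exact: (fps_comp_morph (intmul 1 : {rmorphism int -> R[i]})).
by rewrite fps_compA // ?f0 // fa_phi0.
Qed.

Lemma psi1_phi1 : fa_phi D 1 * fa_psi D 1 = 1.
Proof.
have := congr1 (fun u => u 1%N) (fa_psiK D); rewrite /fps_X /= /fps_comp.
rewrite !big_ord_recr big_ord0 /= add0r coefD !coefZ expr0 expr1 coef1 mulr0 add0r.
by rewrite coef_poly.
Qed.

(** The leading coefficient is [phi_1^e = psi_1^-e], and both norms carry the same capacitary
    factor; so the jet norm is the norm of [D psi (d/dT)] to the power [-e], and pseudoconvexity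
    says that the latter norm exceeds 1. *)
Lemma jet_norm_lt1 f e : pseudoconvex D -> (0 < e)%N -> (forall n, (n < e)%N -> f n = 0) ->
  f e = 1 -> ln (cap_norm_dual_pow D e (formal_germ D f e)) < 0.
Proof.
rewrite /pseudoconvex /deg_normal_bundle oppr_lt0 => lnpos e0 f0 fe.
have germE : formal_germ D f e = fa_phi D 1 ^+ e.
  rewrite /formal_germ fps_comp_order ?fa_phi0 //; first by rewrite fe mul1r.
  by move=> n /f0 ->.
pose E : R := expR (- green_const D).
have E0 : 0 < E by exact: expR_gt0.
have c1 : cap_norm D 1 = E by rewrite /cap_norm Normc.normc1 mul1r.
have psi1 : fa_psi D 1 != 0.
  by apply/eqP => p0; have := psi1_phi1; rewrite p0 mulr0 => /esym/eqP; rewrite oner_eq0.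
have gt1 : 1 < normc (fa_psi D 1) * E.
  rewrite ltNge; apply/negP => le1; move: lnpos; rewrite ltNge ln_le0 //.
have -> : cap_norm_dual_pow D e (formal_germ D f e) = (normc (fa_psi D 1) * E)^-1 ^+ e.
  rewrite /cap_norm_dual_pow germE c1 normcX -exprMn; congr (_ ^+ _).
  have -> : fa_phi D 1 = (fa_psi D 1)^-1 by apply: (mulIf psi1); rewrite psi1_phi1 mulVf.
  by rewrite Normc.normcV invfM.
apply: ln_lt0; apply/andP; split.
  by rewrite exprn_gt0 // invr_gt0; apply: lt_trans gt1.
have Q0 : 0 <= (normc (fa_psi D 1) * E)^-1.
  by rewrite invr_ge0 ltW // (lt_trans ltr01).
have Q1 : (normc (fa_psi D 1) * E)^-1 < 1.
  by rewrite invf_lt1 // (lt_trans ltr01).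
by rewrite exprn_ilt1 // -lt0n.
Qed.

(** A constant monic polynomial is 1, whose value at [O] does not exceed 1. Thus [d] is positive. *)
Lemma size_inf_abs_eval p F : p \is monic -> (1 < inf_abs_eval_inv p F)%E -> (1 < size p)%N.
Proof.
move=> pm; rewrite ltNge; apply: contraNT; rewrite -leqNgt => sp.
apply: ge_ereal_inf; exists (abs_eval_inv p (F O)); first by exists O => //; exact: fa_O_V.
have pE : p = 1.
  by move: pm; rewrite (size1_polyC sp) monicE lead_coefC => /eqP ->; rewrite polyC1.
by rewrite /abs_eval_inv pE size_poly1 andbF rmorph1 hornerC Normc.normc1.
Qed.

(** For [w != 0] the quotient [w^d / q(w)] is [1 / p(1/w)]. At [w = 0], where the convention gives
    [+oo], monicity gives [q(0) = 1] and the quotient is 0. *)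
Lemma abs_eval_inv_gt1 p (w : CC R) : p \is monic -> (1 < size p)%N -> (1 < abs_eval_inv p
    w)%E ->
  let q := map_poly (real_complex R) (rev_poly p) in
  q.[w] != 0 /\ normc (w ^+ (size p).-1 / q.[w]) < 1.
Proof.
move=> pm sp; rewrite /abs_eval_inv sp andbT /=.
have qE : map_poly (real_complex R) (rev_poly p) = rev_poly (map_poly (real_complex R) p).
  by apply/polyP => i; rewrite coef_map coef_poly [RHS]coef_poly size_map_poly coef_map;
      case: ifP.
have [->|w0] := eqVneq w 0.
  have -> : (map_poly (real_complex R) (rev_poly p)).[0] = 1.
    by rewrite horner_coef0 coef_map coef0_rev_poly.
  move=> _; rewrite oner_eq0; split=> //.
  have -> : (0 : CC R) ^+ (size p).-1 / 1 = 0.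
    by case: (size p) sp => [|[|n]] // _; rewrite exprS !mul0r.
  by rewrite Normc.normc0 ltr01.
rewrite lte_fin qE horner_rev_poly // size_map_poly => p1.
have pw : (map_poly (real_complex R) p).[w^-1] != 0 by rewrite -normc_gt0 (lt_trans ltr01).
split; first by rewrite mulf_neq0 // expf_neq0.
by rewrite invfM mulrA mulfV ?expf_neq0 // mul1r Normc.normcV invf_lt1 // (lt_trans ltr01).
Qed.

Lemma integral_series_of_polynomial (f : nat -> int) (p : {poly R}) (Phi : D -> CC R) :
  f 0%N = 0 -> holomorphic_near_V (formal_germ D f) Phi -> p \is monic ->
  (1 < inf_abs_eval_inv p Phi)%E ->
  exists2 G : (nat -> bool) -> nat -> int, injective G &
    forall s, integral_holomorphic_series D (fps_comp (G s) f).
Proof.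
move=> f0 [W [oW cW VW hPhi PhiT]] pm pinf.
have sp := size_inf_abs_eval pm pinf; set d := (size p).-1.
have d0 : (0 < d)%N by rewrite /d; case: (size p) sp => [|[|n]].
pose q := rev_poly p; have q1 : q`_0 = 1 by exact: coef0_rev_poly.
(* The matrix of coefficients of [X^(m mod d) h^(m div d)]: truncation at order [k + 1] does not
   affect degree [k], and the diagonal is 1. *)
pose T k m := (twisted_monomial q d k.+1 m)`_k.
have T1 k : T k k = 1 by exact: twisted_monomial_lead.
exists (rounded T); first exact: rounded_inj.
move=> s; pose b := rounding_coef T s.
have b2 m : `|b m| <= 2 := rounding_coef_bound T s m.
have GE k : (rounded T s k)%:~R = \sum_(m < k.+1) b m * (twisted_monomial q d k.+1 m)`_k.
  exact: roundedE.
pose qC := map_poly (real_complex R) q.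
pose Om := [set w : CC R | qC.[w] != 0 /\ normc (w ^+ d / qC.[w]) < 1].
pose K := limit_function q d b.
have PhiOm x : V x -> Om (Phi x).
  move=> Vx; apply: abs_eval_inv_gt1 => //; apply: lt_le_trans pinf _.
  by apply: ereal_inf_lbound; exists x.
have Om_nbhs w : Om w -> nbhs w Om.
  by move=> Ow; apply: open_nbhs_nbhs; split=> //; exact: horner_ratio_open.
(* The polynomial controls [Phi] on [V] only; as [Om] is open and [Phi] continuous, the control
   persists on a neighborhood. *)
pose U := [set x | W x /\ Om (Phi x)].
have oU : open U.
  rewrite openE => x [Wx Ox]; apply: filterI.
    by apply: open_nbhs_nbhs; split.
  by apply: (holomorphic_continuous hPhi Wx); exact: Om_nbhs.
have VU : V `<=` U by move=> x Vx; split; [exact: VW|exact: PhiOm].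
have V0 : V !=set0 by exists (fa_O D); exact: fa_O_V.
have [W' [oW' cW' VW' W'U]] := connected_open_refine V0 (@bs_connected _ D) oU VU.
exists (K \o Phi); exists W'; split; [exact: oW'|exact: cW'|exact: VW'| |].
  apply: holomorphic_comp; first by apply: holomorphic_sub hPhi => x /W'U[].
  by move=> x /W'U[_ [? ?]]; exact: limit_function_derivable.
have [r [M [r0 cM]]] := taylor_coef_bound PhiT.
have c0 : formal_germ D f 0 = 0 by rewrite /formal_germ fps_comp0 f0.
have [e e0 eP] := series_comp_cvg q1 d0 b2 GE c0 r0 cM.
rewrite (formal_germ_comp _ f0).
have zn : \forall x \near fa_O D, normc (cmap (fa_z D) x) < e.
  apply: filterS (chart_nbhs (fa_z_dom D) e0) => x [_].
  by rewrite fa_z_O subr0.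
apply: filterS (filterI zn PhiT) => x [zx xc]; exact: eP zx xc.
Qed.

End Surfaces.

Theorem theorem1p1 (R : realType) (D : formal_analytic_surface R)
  (hD : pseudoconvex D)
  (f : nat -> int) (e : nat) (he : (1 <= e)%N)
  (hf_low : forall n : nat, (n < e)%N -> f n = 0)
  (hf_monic : f e = 1)
  (Phi : D -> CC R) (hPhi : holomorphic_near_V (formal_germ D f) Phi)
  (hconj : ln (cap_norm_dual_pow D e (formal_germ D f e)) < 0 ->
     sigma_real Phi ->
     exists p : {poly R}, p \is monic /\ (1 < inf_abs_eval_inv p Phi)%E) :
  integral_holomorphic_series D #= [set: R].
Proof.
have [p [pm pinf]] := hconj (jet_norm_lt1 hD he hf_low hf_monic) (sigma_real_of_holomorphic
    hPhi).
have [G Ginj GP] := integral_series_of_polynomial (hf_low 0%N he) hPhi pm pinf.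
apply: (card_eq_continuum (f := fun s => fps_comp (G s) f)) GP.
by move=> s s' /(fps_comp_inj he hf_low hf_monic) /Ginj.
Qed.
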